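(* Let $A$ be a Boolean $n\times n$ matrix and $r\in\mathbb{N}$. Algorithm 1 (described in the context), applied to the input $(A,r)$, is well-defined. It finds the global solution of the problem $$\rho(X)\ \to\ \min\quad\text{subject to}\quad X\in\mathcal{B}(A,r)$$ in a finite number of steps, i.e. the statements asserted in the description of the algorithm are correct, the algorithm does not cycle and terminates after finitely many steps, and the matrix $\widehat X$ it returns is a solution of this problem.
   Context: Notation. $\mathcal V=\{1,\ldots,n\}$; Boolean means with entries in $\{0,1\}$; ${\rm supp}\,x=\{j: x_j\neq 0\}$; $\rho$ is the spectral radius; $A_i$ is the $i$th row of $A$. For a row $a$, $\mathcal{B}(a,r)$ is the set of entrywise non-negative rows $x$ of the same length with $\sum_j|a_j-x_j|\le r$. $\mathcal{B}(A,r)$ is the set of matrices whose $i$th row belongs to $\mathcal{B}(A_i,r)$ for each $i=1,\ldots,n$. For $\mathcal S\subset\mathcal V$, $X|_{\mathcal S}$ is the principal submatrix of $X$ with index set $\mathcal S$, and $x|_{\mathcal S}$ is the restriction of a vector or row $x$ to the indices in $\mathcal S$. For a non-negative square matrix $X$, the leading eigenvalue is $\lambda_{\max}=\rho(X)$, and a leading eigenvector is a non-zero entrywise non-negative vector $v$ with $Xv=\rho(X)v$. A leading eigenvector is minimal if no other leading eigenvector has a strictly smaller (by inclusion) support. If $X$ has a strictly positive minimal leading eigenvector, then its leading eigenvalue is simple, and the basic set of $X$ is the support of the leading eigenvector of $X^T$ (unique up to normalisation). Minimal rows. Let $a$ be a Boolean row and $v$ an entrywise non-negative vector of the same length. A Boolean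 row $x\in\mathcal{B}(a,r)$ is minimal in $\mathcal{B}(a,r)$ with respect to $v$ if $x_j=0$ for $j\notin{\rm supp}\,a$ and the set $\mathcal J=\{j\in{\rm supp}\,a: x_j=0\}$ occupies the $r$ largest components of $v$ on ${\rm supp}\,a$, i.e. $|\mathcal J|=\min\{r,|{\rm supp}\,a|\}$ and $v_j\ge v_k$ for all $j\in\mathcal J$, $k\in{\rm supp}\,a\setminus\mathcal J$. (If there are several minimal rows, any of them may be taken.) Algorithm 1. Input: a Boolean $n\times n$ matrix $A$ and $r\in\mathbb{N}$. Output: a matrix $\widehat X$. Set $X^{(1)}=A$, $k=1$. ( * ) $k$th iteration. We have a Boolean $n\times n$ matrix $X^{(k)}$. If $\rho(X^{(k)})<1$, stop and return $\widehat X=X^{(k)}$. Otherwise put $X=X^{(k)}$, compute a minimal leading eigenvector $v$ of $X$ (any one if there are several), and set $\mathcal S={\rm supp}\,v$, $X'=X|_{\mathcal S}$, $v'=v|_{\mathcal S}$. ( ** ) Main loop. The input is a triple $(X,v,\mathcal S)$, where $X$ is a Boolean $n\times n$ matrix, $v$ is a minimal leading eigenvector of $X$ and $\mathcal S={\rm supp}\,v$, with corresponding $X'=X|_{\mathcal S}$, $v'=v|_{\mathcal S}$ (so $v'$ is a strictly positive minimal leading eigenvector of $X'$). Write $A'_i=A_i|_{\mathcal S}$ and $X'_i=X_i|_{\mathcal S}$ for $i\in\mathcal S$. Let $\mathcal H\subset\mathcal S$ be the basic set of $X'$, and let $\mathcal I$ be the set of $i\in\mathcal S$ such that the row $X'_i$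 is minimal in $\mathcal{B}(A'_i,r)$ with respect to $v'$. - If $\mathcal I=\mathcal S$, stop and return the $n\times n$ matrix $\widehat X$ defined by $\widehat X_i=X_i$ for $i\in\mathcal S$ and $\widehat X_i=A_i$ for $i\notin\mathcal S$. - Otherwise define $\tilde X$: if $i\in\mathcal I$ or $i\notin\mathcal S$, then $\tilde X_i=X_i$; if $i\in\mathcal S\setminus\mathcal I$, then $\tilde X_i|_{\mathcal S}$ is the minimal row in $\mathcal{B}(A'_i,r)$ with respect to $v'$, and $\tilde X_{ij}=A_{ij}$ for all $j\notin\mathcal S$. Put $\tilde X'=\tilde X|_{\mathcal S}$. - If $\mathcal H\subset\mathcal I$ (asserted: then $\rho(\tilde X')=\rho(X')$ and the leading eigenvalue of $\tilde X'$ is simple): compute the minimal leading eigenvector $\tilde v'$ of $\tilde X'$, let $\tilde v$ be its extension by zeros to $\mathcal V$, and set $X=\tilde X$, $v=\tilde v$. If $\tilde v'>0$, keep $\mathcal S$ and go to ( ** ) with $X'=\tilde X'$, $v'=\tilde v'$. Otherwise replace $\mathcal S$ by ${\rm supp}\,\tilde v$, set $X'=\tilde X|_{\mathcal S}$, $v'=\tilde v|_{\mathcal S}$, and go to ( ** ). - If $\mathcal H\not\subset\mathcal I$ (asserted: then $\rho(\tilde X)<\rho(X)$): set $X^{(k+1)}=\tilde X$, increase $k$ by one, and go to ( * ). Well-definedness means that at each iteration the matrix $X'$ has a leading eigenvector that is unique up to normalisation.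
   Formalization: Two corrections: when I = S the current X is returned (rows outside S are not reset to those of A); and for H not in I the assertion is ρ(X̃') < ρ(X'), with ρ(X̃) < ρ(X) only if the leading eigenvalue of X is simple. The literal forms fail, e.g. for J₂⊕J₂ and I₂ with r = 1. *)

(* Defs.v *)
From mathcomp Require Import all_boot all_order all_algebra.
From mathcomp Require Import complex.
From mathcomp Require Import boolp classical_sets reals.
From Stdlib Require Export Relation_Operators.

Set Implicit Arguments.
Unset Strict Implicit.
Unset Printing Implicit Defensive.

Import Order.TTheory GRing.Theory Num.Theory.

Local Open Scope ring_scope.

Section Matrices.
Variable R : realType.

Definition boolean_mx m n (X : 'M[R]_(m, n)) : Prop :=
  forall i j, X i j = 0 \/ X i j = 1.

(* Complex eigenvalues; the set is finite, and empty only for 0 x 0 matrices,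
   where [sup] is 0. *)
Definition spectral_radius n (X : 'M[R]_n) : R :=
  sup [set ComplexField.Normc.normc z
      | z in [set z : R[i] | eigenvalue (map_mx (real_complex R) X) z]]%classic.

Local Notation rho := spectral_radius.

Definition supp n (v : 'cV[R]_n) : {set 'I_n} := [set j | v j 0 != 0].

Definition row_ball n (a : 'rV[R]_n) (r : nat) (x : 'rV[R]_n) : Prop :=
  (forall j, 0 <= x 0 j) /\ \sum_j `|a 0 j - x 0 j| <= r%:R.

Definition mx_ball n (A : 'M[R]_n) (r : nat) (X : 'M[R]_n) : Prop :=
  forall i, row_ball (row i A) r (row i X).

Definition solution n (A : 'M[R]_n) (r : nat) (X : 'M[R]_n) : Prop :=
  mx_ball A r X /\ forall Y, mx_ball A r Y -> rho X <= rho Y.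

(* Restrictions to S are indexed by 'I_#|S| through the enumeration of S. *)
Definition mx_restr n (S : {set 'I_n}) (X : 'M[R]_n) : 'M[R]_#|S| :=
  mxsub (fun k : 'I_#|S| => enum_val k) (fun k : 'I_#|S| => enum_val k) X.

Definition row_restr n (S : {set 'I_n}) (x : 'rV[R]_n) : 'rV[R]_#|S| :=
  colsub (fun k : 'I_#|S| => enum_val k) x.

Definition vec_restr n (S : {set 'I_n}) (v : 'cV[R]_n) : 'cV[R]_#|S| :=
  rowsub (fun k : 'I_#|S| => enum_val k) v.

Definition leading_eigenvector n (X : 'M[R]_n) (v : 'cV[R]_n) : Prop :=
  [/\ v != 0, forall i, 0 <= v i 0 & X *m v = rho X *: v].

Definition minimal_leading n (X : 'M[R]_n) (v : 'cV[R]_n) : Prop :=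
  leading_eigenvector X v /\
  forall w, leading_eigenvector X w -> ~~ (supp w \proper supp v).

Definition leading_simple n (X : 'M[R]_n) : Prop :=
  mup (rho X) (char_poly X) = 1%N.

(* [H] is a basic set of X|_S, as a set of indices of X. *)
Definition basic_set n (S : {set 'I_n}) (X : 'M[R]_n) (H : {set 'I_n}) : Prop :=
  exists2 u, leading_eigenvector (mx_restr S X)^T u
           & H = [set enum_val k | k in supp u].

Definition minimal_row n (a : 'rV[R]_n) (r : nat) (v : 'cV[R]_n)
    (x : 'rV[R]_n) : Prop :=
  let J := [set j in supp a^T | x 0 j == 0] in
  [/\ boolean_mx x, row_ball a r x,
      forall j, j \notin supp a^T -> x 0 j = 0,
      #|J| = minn r #|supp a^T|
    & forall j k, j \in J -> k \in supp a^T :\: J -> v k 0 <= v j 0].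

Definition minimal_rows n (A : 'M[R]_n) (r : nat) (X : 'M[R]_n)
    (v : 'cV[R]_n) (S : {set 'I_n}) : {set 'I_n} :=
  [set i in S | `[< minimal_row (row_restr S (row i A)) r (vec_restr S v)
                                (row_restr S (row i X)) >]].

(* A relation, because ties between minimal rows may be broken arbitrarily. *)
Definition update n (A : 'M[R]_n) (r : nat) (X : 'M[R]_n) (v : 'cV[R]_n)
    (S : {set 'I_n}) (Y : 'M[R]_n) : Prop :=
  forall i,
    if i \in S :\: minimal_rows A r X v S then
      minimal_row (row_restr S (row i A)) r (vec_restr S v)
                  (row_restr S (row i Y)) /\
      (forall j, j \notin S -> Y i j = A i j)
    else row i Y = row i X.

(* [Outer X]: at the start of an outer iteration, with current matrix X;
   [Loop X v S]: at the entry of the main loop, with input (X, v, S). *)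
Inductive state n : Type :=
| Outer of 'M[R]_n
| Loop of 'M[R]_n & 'cV[R]_n & {set 'I_n}
| Returned of 'M[R]_n.

(* [step_return] keeps the current rows of X outside S. Resetting them to the
   rows of A would undo the earlier iterations: for r = 1 and A block diagonal
   with two 2 x 2 all-ones blocks, the minimum is 1, but every run would then
   return a matrix of spectral radius 2. *)
Inductive step n (A : 'M[R]_n) (r : nat) : state n -> state n -> Prop :=
| step_stable X :
    rho X < 1 ->
    step A r (Outer X) (Returned X)
| step_enter X v :
    1 <= rho X -> minimal_leading X v ->
    step A r (Outer X) (Loop X v (supp v))
| step_return X v S :
    minimal_rows A r X v S = S ->
    step A r (Loop X v S) (Returned X)
| step_keep X v S H Y w :
    minimal_rows A r X v S <> S -> update A r X v S Y ->
    basic_set S X H -> H \subset minimal_rows A r X v S ->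
    minimal_leading (mx_restr S Y) (vec_restr S w) ->
    (forall j, j \notin S -> w j 0 = 0) ->
    (forall k, 0 < vec_restr S w k 0) ->
    step A r (Loop X v S) (Loop Y w S)
| step_shrink X v S H Y w :
    minimal_rows A r X v S <> S -> update A r X v S Y ->
    basic_set S X H -> H \subset minimal_rows A r X v S ->
    minimal_leading (mx_restr S Y) (vec_restr S w) ->
    (forall j, j \notin S -> w j 0 = 0) ->
    ~ (forall k, 0 < vec_restr S w k 0) ->
    step A r (Loop X v S) (Loop Y w (supp w))
| step_descend X v S H Y :
    minimal_rows A r X v S <> S -> update A r X v S Y ->
    basic_set S X H -> ~~ (H \subset minimal_rows A r X v S) ->
    step A r (Loop X v S) (Outer Y).

Definition reachable n (A : 'M[R]_n) (r : nat) (s : state n) : Prop :=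
  clos_refl_trans _ (step A r) (Outer A) s.

End Matrices.

(* Main.v *)
Require Import Defs.
From Stdlib Require Operators_Properties.
From mathcomp Require Import boolp classical_sets.
From mathcomp Require Import all_boot all_order all_algebra.
From mathcomp Require Import reals.
From mathcomp Require Import perm complex polyrcf ring lra.

Import Order.TTheory GRing.Theory Num.Theory.
Local Open Scope ring_scope.

Set Implicit Arguments.
Unset Strict Implicit.
Unset Printing Implicit Defensive.

(** For a nonnegative matrix the spectral radius [rho] is the largest real root
    of the characteristic polynomial ([spectral_radiusP]) and has a nonnegative
    eigenvector ([leading_exists]).  Both follow from inverse monotonicity of
    [t - X] above all real eigenvalues ([inverse_monotone]), proved by Gaussian
    elimination.  Hence [c <= rho] if [c x <= X x] for some nonzero [x >= 0], and
    [rho <= c] if [X v <= c v] for some [v > 0].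

    Let [v] be the current eigenvector, [S] its support, and [X'], [Y'] the
    restrictions to [S] of the current matrix and of its update.  Entries with
    row outside [S] and column in [S] vanish, so these matrices are block
    triangular, and the spectrum changes only through the diagonal block [S].
    Minimality of [v] makes the left and right eigenvectors of [X'] for [rho]
    unique.  A minimal row has the least inner product with [v] among the rows of
    the ball, so [Y' v <= rho v], with equality exactly in the rows of [X'] that
    are already minimal.  A left eigenvector [z >= 0] of [Y'] for [rho] then lives
    on those rows ([left_subinvariant]), where [X'] and [Y'] agree, so it is also
    the left eigenvector of [X'], whose support is the basic set [H].  Therefore
    [rho] drops if some row of [H] is not minimal; otherwise [rho] stays and is a
    simple eigenvalue ([lowered_no_chain] excludes Jordan chains).

    Within the main loop [H] is fixed, and the eigenvector, normalised on [H],
    strictly decreases ([lowered_progress]).  An outer iteration lowers [rho], or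
    keeps it and lowers its multiplicity: the block outside [S] is unchanged, and
    the block [S] loses its root [rho] ([update_descend_radius]).  So the main
    loop never meets a matrix twice, and as there are finitely many Boolean
    matrices every run is finite.

    A matrix returned from the main loop satisfies [rho v <= Y v] for every [Y] in
    the ball, since all its rows are minimal; hence [rho] is at most the
    spectral radius of [Y].  A Boolean matrix with [rho < 1] has [rho = 0]. *)

(** * Polynomials near and above their largest real root *)

Section RealPolynomials.
Variable R : realType.
Implicit Types (p q : {poly R}) (a t : R).

Lemma horner_ge0_right q a :
  (forall t, a < t -> 0 <= q.[t]) -> 0 <= q.[a].
Proof.
move=> q_ge0; rewrite leNgt; apply/negP => qa_lt0.
have [|d d_gt0 Hd] := @poly_cont R a q (- q.[a]); first by rewrite oppr_gt0.
have /Hd : `|a + d / 2 - a| < d by rewrite addrC addKr gtr0_norm; lra.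
have : a < a + d / 2 by lra.
by move/q_ge0; rewrite ltr_norml => ? /andP[_ ?]; lra.
Qed.

Lemma last_root p a : p \is monic -> p.[a] <= 0 ->
  exists m, [/\ a <= m, root p m & forall t, m < t -> 0 < p.[t]].
Proof.
move=> p_monic pa_le0.
have [M pM] := @poly_pinfty_gt_lc R p ltac:(by rewrite (monicP p_monic)).
rewrite (monicP p_monic) in pM.
have root_above t : p.[t] <= 0 -> exists2 s, t <= s & root p s.
  move=> pt_le0; have [||s /andP[ts _] ps] := @poly_ivt R p t (Num.max t M).
  - by rewrite le_max lexx.
  - by rewrite pt_le0 (le_trans ler01) ?pM // le_max lexx orbT.
  by exists s.
have top k q : (size q <= k)%N -> q != 0 -> forall t, root q t ->
    exists2 m, t <= m & root q m /\ forall s, m < s -> ~~ root q s.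
  elim: k q => [|k IHk] q; first by rewrite leqn0 size_poly_eq0 => ->.
  move=> q_le q_neq0 t qt0; have /factor_theorem[q1 q_def] := qt0.
  have q1_neq0 : q1 != 0 by apply: contra q_neq0 => /eqP q10; rewrite q_def q10 mul0r.
  have [[s ts qs]|no_root] := pselect (exists2 s, t < s & root q s); last first.
    exists t => //; split=> // s ts; apply/negP => qs; apply: no_root.
    by exists s.
  have q1_le : (size q1 <= k)%N.
    move: q_le; rewrite q_def size_Mmonic ?monicXsubC // size_XsubC addn2 /=.
    by rewrite ltnS.
  have q1s : root q1 s.
    move: qs; rewrite q_def rootM root_XsubC => /orP[//|/eqP s_eq].
    by rewrite s_eq ltxx in ts.
  have [m sm [q1m Hm]] := IHk _ q1_le q1_neq0 _ q1s.
  exists m; first exact: le_trans (ltW ts) sm.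
  split=> [|x mx]; first by rewrite q_def rootM q1m.
  rewrite q_def rootM root_XsubC negb_or Hm //=.
  by rewrite gt_eqF // (lt_trans ts) // (le_lt_trans sm).
have [s as_ ps] := root_above a pa_le0.
have [m sm [pm Hm]] := top _ p (leqnn _) (monic_neq0 p_monic) s ps.
exists m; split=> // [|t mt]; first exact: le_trans sm.
rewrite ltNge; apply/negP => /root_above[x tx px].
by have := Hm x (lt_le_trans mt tx); rewrite px.
Qed.

End RealPolynomials.

(** * Perron-Frobenius theory *)

Section Entries.
Variable K : nzRingType.

Lemma mx_addE m n (X Y : 'M[K]_(m, n)) i j : (X + Y) i j = X i j + Y i j.
Proof. by rewrite mxE. Qed.

Lemma mx_oppE m n (X : 'M[K]_(m, n)) i j : (- X) i j = - X i j.
Proof. by rewrite mxE. Qed.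

Lemma mx_scaleE m n c (X : 'M[K]_(m, n)) i j : (c *: X) i j = c * X i j.
Proof. by rewrite mxE. Qed.

Definition entryE := (mx_addE, mx_oppE, mx_scaleE).

End Entries.

Section CharPoly.
Variable R : comNzRingType.

Lemma horner_char_poly_mx n (X : 'M[R]_n) t :
  map_mx (horner_eval t) (char_poly_mx X) = t%:M - X.
Proof.
apply/matrixP => i j; rewrite !mxE /= horner_evalE.
by rewrite hornerD hornerN hornerC hornerMn hornerX.
Qed.

Lemma horner_char_poly n (X : 'M[R]_n) t :
  (char_poly X).[t] = \det (t%:M - X).
Proof. by rewrite -[_.[t]]/(horner_eval t _) -det_map_mx horner_char_poly_mx. Qed.

Lemma char_poly_tr n (X : 'M[R]_n) : char_poly X^T = char_poly X.
Proof.
rewrite /char_poly -det_tr; congr (\det _).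
by apply/matrixP => i j; rewrite !mxE eq_sym.
Qed.

Lemma char_poly_ublock n1 n2 (X : 'M[R]_n1) (Y : 'M[R]_(n1, n2)) (Z : 'M[R]_n2) :
  char_poly (block_mx X Y 0 Z) = char_poly X * char_poly Z.
Proof.
rewrite /char_poly /char_poly_mx map_block_mx scalar_mx_block opp_block_mx.
by rewrite add_block_mx !(raddf0, add0r) det_ublock.
Qed.

Lemma char_poly_lblock n1 n2 (X : 'M[R]_n1) (Y : 'M[R]_(n2, n1)) (Z : 'M[R]_n2) :
  char_poly (block_mx X 0 Y Z) = char_poly X * char_poly Z.
Proof.
rewrite /char_poly /char_poly_mx map_block_mx scalar_mx_block opp_block_mx.
by rewrite add_block_mx !(raddf0, add0r) det_lblock.
Qed.

End CharPoly.

Section PerronFrobenius.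
Variable R : realType.
Local Notation rho := (@spectral_radius R _).
Implicit Types (s t : R).

Definition nneg_mx m n (X : 'M[R]_(m, n)) := forall i j, 0 <= X i j.

Lemma nneg_mul m n p (X : 'M[R]_(m, n)) (Y : 'M[R]_(n, p)) :
  nneg_mx X -> nneg_mx Y -> nneg_mx (X *m Y).
Proof. by move=> X0 Y0 i j; rewrite mxE sumr_ge0 // => k _; rewrite mulr_ge0. Qed.

Lemma nneg_tr m n (X : 'M[R]_(m, n)) : nneg_mx X -> nneg_mx X^T.
Proof. by move=> X0 i j; rewrite mxE. Qed.

(** Elimination of the last [n] unknowns; [g] stands for [(s - D)^-1 c], which
    keeps matrix inverses out of the statement. *)
Lemma det_schur n (a : 'M[R]_1) (b : 'rV[R]_n) (c : 'cV[R]_n) (D : 'M[R]_n)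
    (g : 'cV[R]_n) s : (s%:M - D) *m g = c ->
  (char_poly (block_mx a b c D)).[s] =
  (s - a 0 0 - (b *m g) 0 0) * (char_poly D).[s].
Proof.
move=> g_def; rewrite !horner_char_poly.
have -> : s%:M - block_mx a b c D = block_mx (s%:M - a) (- b) (- c) (s%:M - D).
  by rewrite scalar_mx_block opp_block_mx add_block_mx !add0r.
rewrite -[LHS]mulr1.
have <- : \det (block_mx (1%:M : 'M[R]_1) 0 g 1%:M) = 1.
  by rewrite det_lblock !det1 mulr1.
rewrite -det_mulmx mulmx_block !mulmx1 !mulmx0 !add0r g_def addNr det_ublock.
by rewrite mulNmx det_mx11 !mxE eqxx mulr1n.
Qed.

(** Elimination of all unknowns but the first from [t - X] leaves the pivot
    [t - a - b g], where [(t - D) g = c] and [g] is nonnegative by induction;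
    the pivot is positive, being the quotient of the characteristic polynomials
    of [X] and [D].  The polynomial of [D] has no root above [t] either: at its
    largest root the polynomial of [X] would be nonpositive. *)
Lemma inverse_monotone n (X : 'M[R]_n) t (x : 'cV[R]_n) :
    nneg_mx X -> (forall s, t <= s -> 0 < (char_poly X).[s]) ->
    (forall i, (X *m x) i 0 <= t * x i 0) ->
  nneg_mx x.
Proof.
elim: n X t x => [|n IHn] X t x X0 pX Xx; first by case.
pose a := ulsubmx (X : 'M_(1 + n)); pose b := ursubmx (X : 'M_(1 + n)).
pose c := dlsubmx (X : 'M_(1 + n)); pose D := drsubmx (X : 'M_(1 + n)).
have X_def : X = block_mx a b c D by rewrite /a /b /c /D submxK.
have b0 : nneg_mx b by move=> i j; rewrite !mxE.
have c0 : nneg_mx c by move=> i j; rewrite !mxE.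
have D0 : nneg_mx D by move=> i j; rewrite !mxE.
have gP s : (forall u, s <= u -> 0 < (char_poly D).[u]) ->
    exists2 g, (s%:M - D) *m g = c & nneg_mx g.
  move=> pD; exists (invmx (s%:M - D) *m c).
    rewrite mulmxA mulmxV ?mul1mx // unitmxE -horner_char_poly.
    by rewrite unitfE gt_eqF ?pD.
  apply: (IHn D s) => // i.
  set g := _ *m c.
  have : (s%:M - D) *m g = c.
    rewrite mulmxA mulmxV ?mul1mx // unitmxE -horner_char_poly.
    by rewrite unitfE gt_eqF ?pD.
  move/matrixP/(_ i 0); rewrite mulmxBl mul_scalar_mx !mxE => g_eq.
  by rewrite -subr_ge0 g_eq; have := c0 i 0; rewrite !mxE.
have bg0 (g : 'cV[R]_n) : nneg_mx g -> 0 <= (b *m g) 0 0 by move=> g0; apply: nneg_mul.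
have pD s : t <= s -> 0 < (char_poly D).[s].
  move=> ts; rewrite ltNge; apply/negP => /(last_root (char_poly_monic D)).
  case=> m [sm /rootP Dm Hm].
  have : 0 <= (char_poly D * ('X - (a 0 0)%:P) - char_poly X).[m].
    apply: horner_ge0_right => u mu; have [|g g_eq g0] := gP u.
      by move=> v uv; apply/Hm/(lt_le_trans mu).
    rewrite !hornerE X_def (det_schur _ _ g_eq).
    rewrite [X in 0 <= X](_ : _ = (b *m g) 0 0 * (char_poly D).[u]); last by ring.
    by rewrite mulr_ge0 ?bg0 // ltW // Hm.
  rewrite !hornerE Dm mul0r sub0r oppr_ge0 leNgt pX //.
  exact: le_trans sm.
have [g g_eq g0] := gP t pD.
have pivot : 0 < t - a 0 0 - (b *m g) 0 0.
  have := pX t (lexx t); rewrite X_def (det_schur _ _ g_eq).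
  by rewrite pmulr_lgt0 // pD.
pose x1 := usubmx (x : 'cV_(1 + n)); pose x2 := dsubmx (x : 'cV_(1 + n)).
have x_def : x = col_mx x1 x2 by rewrite vsubmxK.
have Xx_def : X *m x = col_mx (a *m x1 + b *m x2) (c *m x1 + D *m x2).
  by rewrite X_def x_def -mul_block_col.
have x2_ge : nneg_mx (x2 - x1 0 0 *: g).
  apply: (IHn D t) => // i.
  have le_i : (c *m x1 + D *m x2) i 0 <= t * x2 i 0.
    have := Xx (rshift 1 i : 'I_(1 + n)); rewrite Xx_def x_def.
    by congr (_ <= _ * _); apply: col_mxEd.
  have /matrixP/(_ i 0) := g_eq.
  rewrite mulmxBl mul_scalar_mx mulmxBr -scalemxAr => g_i.
  have cx : (c *m x1) i 0 = c i 0 * x1 0 0 by rewrite mxE big_ord1.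
  move: le_i g_i; rewrite !entryE cx => le_i g_i.
  by move: le_i; rewrite -g_i; lra.
have x1_ge : 0 <= x1 0 0.
  have le_0 : (a *m x1 + b *m x2) 0 0 <= t * x1 0 0.
    have := Xx (lshift n 0 : 'I_(1 + n)); rewrite Xx_def x_def.
    by congr (_ <= _ * _); apply: col_mxEu.
  have ax : (a *m x1) 0 0 = a 0 0 * x1 0 0 by rewrite mxE big_ord1.
  have := bg0 _ x2_ge; rewrite mulmxBr -scalemxAr !entryE => bx.
  rewrite !entryE ax in le_0.
  by rewrite -(pmulr_rge0 _ pivot); lra.
have x_l k : x (lshift n k : 'I_(1 + n)) 0 = x1 k 0 by rewrite mxE.
have x_r k : x (rshift 1 k : 'I_(1 + n)) 0 = x2 k 0 by rewrite mxE.
move=> i j; rewrite ord1; case: (split_ordP (i : 'I_(1 + n))) => k ->.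
  by rewrite x_l ord1.
rewrite x_r; have := x2_ge k 0; rewrite !entryE.
by have := mulr_ge0 x1_ge (g0 k 0); lra.
Qed.

Definition dot n (u v : 'cV[R]_n) : R := \sum_i u i 0 * v i 0.

Lemma dot_tr m n (X : 'M[R]_(m, n)) u v : dot u (X *m v) = dot (X^T *m u) v.
Proof.
rewrite /dot; under eq_bigr do rewrite mxE mulr_sumr.
rewrite exchange_big; apply: eq_bigr => j _; rewrite mxE mulr_suml.
by apply: eq_bigr => i _; rewrite mxE; ring.
Qed.

Lemma dotC n (u v : 'cV[R]_n) : dot u v = dot v u.
Proof. by apply: eq_bigr => i _; rewrite mulrC. Qed.

Lemma dotZr n (u v : 'cV[R]_n) c : dot u (c *: v) = c * dot u v.
Proof. by rewrite mulr_sumr; apply: eq_bigr => i _; rewrite mxE mulrCA. Qed.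

Lemma ler_dot n (u v w : 'cV[R]_n) : nneg_mx u ->
  (forall i, v i 0 <= w i 0) -> dot u v <= dot u w.
Proof. by move=> u0 vw; apply: ler_sum => i _; rewrite ler_wpM2l. Qed.

Lemma dot_eq n (u v w : 'cV[R]_n) : nneg_mx u ->
    (forall i, v i 0 <= w i 0) -> dot u w <= dot u v ->
  forall i, u i 0 != 0 -> v i 0 = w i 0.
Proof.
move=> u0 vw le_uwv i ui; apply/eqP; rewrite eq_le vw /=.
have : dot u w - dot u v <= 0 by rewrite subr_le0.
rewrite /dot -sumrB (bigD1 i) //= -mulrBr => le0.
have : u i 0 * (w i 0 - v i 0) <= 0.
  apply: le_trans le0; rewrite lerDl sumr_ge0 // => j _.
  by rewrite -mulrBr mulr_ge0 // subr_ge0.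
by rewrite pmulr_rle0 ?subr_le0 // lt_neqAle eq_sym ui u0.
Qed.

Lemma cV_neq0 n (x : 'cV[R]_n) : x != 0 -> exists i, x i 0 != 0.
Proof.
move=> x_neq0; apply/existsP; apply: contraR x_neq0 => /existsPn x0.
by apply/eqP/matrixP => i j; rewrite ord1 mxE; apply/eqP; have := x0 i; rewrite negbK.
Qed.

Lemma dot_gt0 n (u v : 'cV[R]_n) : nneg_mx u -> u != 0 ->
  (forall i, 0 < v i 0) -> 0 < dot u v.
Proof.
move=> u0 /cV_neq0[i ui] v0; rewrite /dot (bigD1 i) //=.
apply: ltr_pwDl; first by rewrite mulr_gt0 // lt_neqAle eq_sym ui u0.
by apply: sumr_ge0 => j _; rewrite mulr_ge0 // ltW.
Qed.

Lemma subinvariant_lt n (X : 'M[R]_n) t c (x : 'cV[R]_n) :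
    nneg_mx X -> (forall s, t <= s -> 0 < (char_poly X).[s]) ->
    nneg_mx x -> x != 0 -> (forall i, c * x i 0 <= (X *m x) i 0) ->
  c < t.
Proof.
move=> X0 pX x0 x_neq0 Xx; rewrite ltNge; apply/negP => tc.
have /negP[] := x_neq0; apply/eqP/matrixP => i j; rewrite ord1 mxE.
apply/eqP; rewrite eq_le x0 andbT -oppr_ge0 -mx_oppE.
apply: (inverse_monotone X0 (t := c)) => [s cs|k].
  by apply: pX; apply: le_trans cs.
by rewrite mulmxN !mx_oppE mulrN lerN2.
Qed.

Lemma perron_root n (X : 'M[R]_n) : (0 < n)%N -> nneg_mx X ->
  exists a, [/\ 0 <= a, root (char_poly X) a &
                forall s, a < s -> 0 < (char_poly X).[s]].
Proof.
move=> n_gt0 X0; have [pX|] := pselect (forall s, 0 <= s -> 0 < (char_poly X).[s]).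
  have := @subinvariant_lt _ X 0 0 (const_mx 1) X0 pX.
  rewrite ltxx => H; suff : false by []; apply: H => [i j||i].
  - by rewrite mxE.
  - apply/negP => /eqP/matrixP/(_ (Ordinal n_gt0) 0); rewrite !mxE => /eqP.
    by rewrite oner_eq0.
  - by rewrite mul0r nneg_mul // => k j; rewrite mxE.
move/existsNP => [s /not_implyP[s0 /negP]]; rewrite -leNgt.
move/(last_root (char_poly_monic X)) => [a [sa pa Ha]].
by exists a; split=> //; apply: le_trans sa.
Qed.

Lemma poly_vec_factor n a (w : 'cV[{poly R}]_n) : w != 0 ->
  exists k w1, w = ('X - a%:P) ^+ k *: w1 /\ exists i, ~~ root (w1 i 0) a.
Proof.
move=> w_neq0; have [i wi] : exists i, w i 0 != 0.
  apply/existsP; apply: contraR w_neq0 => /existsPn w0.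
  apply/eqP/matrixP => i j; rewrite ord1 mxE; apply/eqP.
  by have := w0 i; rewrite negbK.
have [m] := ubnP (size (w i 0)).
elim: m w wi {w_neq0} => // m IHm w wi /ltnSE wm.
have [[j wj]|all_root] := pselect (exists j, ~~ root (w j 0) a).
  by exists 0%N, w; rewrite expr0 scale1r; split=> //; exists j.
pose w1 := \col_j (w j 0 %/ ('X - a%:P)).
have w_def : w = ('X - a%:P) *: w1.
  apply/matrixP => j l; rewrite ord1 !mxE mulrC divpK //.
  by rewrite dvdp_XsubCl; apply/negPn/negP => wj; apply: all_root; exists j.
have w1i : w1 i 0 != 0.
  by apply: contraNneq wi => w1i; rewrite w_def mxE w1i mulr0.
have [|k [w2 [w1_def w2P]]] := IHm w1 w1i.
  have /matrixP/(_ i 0) := w_def; rewrite [RHS]mxE => wi_def.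
  apply: leq_trans wm; rewrite wi_def.
  by rewrite size_monicM ?monicXsubC // size_XsubC.
by exists k.+1, w2; split; rewrite // w_def w1_def scalerA exprS.
Qed.

(** The column sums of the adjugate of [t - X] are nonnegative for [t] above
    [a]; after division by the largest common power of [t - a] they stay
    nonnegative, and do not all vanish, at [t = a], where they form an
    eigenvector. *)
Lemma perron_vector n (X : 'M[R]_n) a : nneg_mx X -> 0 <= a ->
    root (char_poly X) a -> (forall s, a < s -> 0 < (char_poly X).[s]) ->
  exists x : 'cV_n, [/\ nneg_mx x, x != 0 & X *m x = a *: x].
Proof.
move=> X0 a0 pa pX; have n_gt0 : (0 < n)%N.
  move: pa; rewrite /root horner_char_poly; case: (n) X {X0 pX} => // X.
  by rewrite det_mx00 oner_eq0.
pose one : 'cV[{poly R}]_n := const_mx 1.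
pose w := \adj (char_poly_mx X) *m one.
have Xw : char_poly_mx X *m w = char_poly X *: one.
  by rewrite mulmxA mul_mx_adj mul_scalar_mx.
have w_neq0 : w != 0.
  apply/negP => /eqP w0; move: Xw; rewrite w0 mulmx0.
  move/matrixP/(_ (Ordinal n_gt0) 0); rewrite !mxE mulr1 => /esym/eqP.
  by rewrite (negPf (monic_neq0 (char_poly_monic X))).
have [k [w1 [w_def [i0 w1i0]]]] := poly_vec_factor a w_neq0.
pose q := char_poly_mx X *m w1.
have q_def i : ('X - a%:P) ^+ k * q i 0 = char_poly X.
  have /matrixP/(_ i 0) := Xw; rewrite w_def -scalemxAr -/q.
  by rewrite !mx_scaleE [one _ _]mxE mulr1.
have q_eval t : map_mx (horner_eval t) q =
    (t%:M - X) *m map_mx (horner_eval t) w1.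
  by rewrite /q map_mxM /= horner_char_poly_mx.
have q_gt0 t i : a < t -> 0 < (q i 0).[t].
  move=> at_; have := pX t at_; rewrite -(q_def i) hornerM horner_exp !hornerE.
  by rewrite pmulr_rgt0 // exprn_gt0 // subr_gt0.
have evalE t i : map_mx (horner_eval t) w1 i 0 = (w1 i 0).[t] by rewrite mxE.
have q_subst t i : (q i 0).[t] = t * (w1 i 0).[t] -
    (X *m map_mx (horner_eval t) w1) i 0.
  have /matrixP/(_ i 0) := q_eval t.
  by rewrite mulmxBl mul_scalar_mx !entryE evalE [LHS]mxE.
have w1_ge0 t i : a < t -> 0 <= (w1 i 0).[t].
  move=> at_; have : nneg_mx (map_mx (horner_eval t) w1).
    apply: (inverse_monotone X0 (t := t)) => [s ts|j].
      by apply: pX; apply: lt_le_trans ts.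
    by have := q_gt0 t j at_; rewrite q_subst evalE; lra.
  by move/(_ i 0); rewrite mxE.
pose x := map_mx (horner_eval a) w1.
have x0 : nneg_mx x.
  move=> i j; rewrite ord1 evalE; apply: horner_ge0_right => t.
  exact: w1_ge0.
have q_ge0 i : 0 <= (q i 0).[a].
  by apply: horner_ge0_right => t /q_gt0 qt; apply: ltW.
have q_const i : q i 0 = q i0 0.
  apply: (@mulfI _ (('X - a%:P) ^+ k)); first by rewrite expf_neq0 ?polyXsubC_eq0.
  by rewrite !q_def.
exists x; split=> //.
  apply: contraNneq w1i0 => /matrixP/(_ i0 0); rewrite evalE mxE => w1i.
  by apply/rootP.
suff qa0 : (q i0 0).[a] = 0.
  apply/matrixP => i j; rewrite ord1.
  have := q_subst a i; rewrite q_const qa0 mx_scaleE evalE -/x; lra.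
(* A left null vector of [a - X] rules out a positive value of [q] at [a]. *)
move: (pa); rewrite -eigenvalue_root_char => /eigenvalueP[z zX z0].
pose y : 'cV[R]_n := \col_i `|z 0 i|.
apply/eqP; rewrite eq_le q_ge0 andbT leNgt; apply/negP => qa_gt0.
have y0 : nneg_mx y by move=> i j; rewrite mxE.
have Xy i : a * y i 0 <= (X^T *m y) i 0.
  rewrite !mxE -[a](ger0_norm a0) -normrM; have /rowP/(_ i) := zX; rewrite !mxE => <-.
  apply: le_trans (ler_norm_sum _ _ _) _; apply: ler_sum => j _.
  by rewrite !mxE normrM (ger0_norm (X0 _ _)) [leRHS]mulrC.
have : dot y (const_mx (q i0 0).[a]) <= 0.
  have -> : const_mx (q i0 0).[a] = a *: x - X *m x.
    by apply/matrixP => i j; rewrite ord1 !entryE evalE -q_subst q_const mxE.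
  have -> : dot y (a *: x - X *m x) = dot x (a *: y) - dot x (X^T *m y).
    rewrite [dot x (X^T *m y)]dotC -dot_tr dotZr (dotC x) -dotZr /dot -sumrB.
    by apply: eq_bigr => i _; rewrite !entryE mulrBr.
  by rewrite subr_le0; apply: ler_dot => // i; rewrite mx_scaleE.
apply/negP; rewrite -ltNge; apply: dot_gt0 => // [|i]; last by rewrite mxE.
have [i zi] : exists i, z 0 i != 0.
  apply/existsP; apply: contraR z0 => /existsPn z0.
  by apply/eqP/rowP => i; rewrite mxE; apply/eqP; have := z0 i; rewrite negbK.
by apply: contraNneq zi => /matrixP/(_ i 0); rewrite !mxE => /normr0_eq0 ->.
Qed.

Local Notation normc := (@ComplexField.Normc.normc R).

Lemma normc_real (x : R) : normc (real_complex R x) = `|x|.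
Proof. by rewrite /normc /= expr0n addr0 sqrtr_sqr. Qed.

Lemma normc_sum n (F : 'I_n -> R[i]) : normc (\sum_i F i) <= \sum_i normc (F i).
Proof.
elim/big_rec2: _ => [|i x z _ zx]; first by rewrite ComplexField.Normc.normc0.
by apply: le_trans (le_normcD _ _) _; rewrite lerD2l.
Qed.

(** The entrywise modulus of a complex left eigenvector for [z] is a
    nonnegative vector that the transpose of [X] multiplies by at least the
    modulus of [z], so that modulus does not exceed the largest real root. *)
Lemma spectral_radius_root n (X : 'M[R]_n) a : nneg_mx X -> 0 <= a ->
    root (char_poly X) a -> (forall s, a < s -> 0 < (char_poly X).[s]) ->
  rho X = a.
Proof.
move=> X0 a0 pa pX; pose XC := map_mx (real_complex R) X.
have eig_a : eigenvalue XC (real_complex R a).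
  by rewrite eigenvalue_root_char /XC -map_char_poly fmorph_root.
have eig_le z : eigenvalue XC z -> normc z <= a.
  move=> /eigenvalueP[y yX y0]; rewrite leNgt; apply/negP => az.
  pose x : 'cV[R]_n := \col_i normc (y 0 i).
  have : normc z < normc z.
    apply: (@subinvariant_lt _ X^T _ _ x (nneg_tr X0)) => [s zs|i j||i].
    - by rewrite char_poly_tr pX // (lt_le_trans az).
    - by rewrite mxE; case: (y 0 i) => u v; apply: sqrtr_ge0.
    - apply: contraNneq y0 => x0; apply/eqP/rowP => i; rewrite mxE.
      have /matrixP/(_ i 0) := x0; rewrite !mxE.
      exact: ComplexField.Normc.eq0_normc.
    rewrite !mxE -ComplexField.Normc.normcM; have /rowP/(_ i) := yX.
    rewrite !mxE => <-; apply: le_trans (normc_sum _) _; apply: ler_sum => j _.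
    rewrite !mxE ComplexField.Normc.normcM normc_real [leRHS]mulrC.
    by rewrite (ger0_norm (X0 _ _)).
  by rewrite ltxx.
rewrite /spectral_radius; set E := (X in sup X).
have Ea : E a by exists (real_complex R a) => //; rewrite normc_real ger0_norm.
have ubE : ubound E a by move=> _ [z /= zE <-]; apply: eig_le.
apply/eqP; rewrite eq_le; apply/andP; split; first by apply: ge_sup => //; exists a.
by apply: ub_le_sup => //; exists a.
Qed.

Lemma spectral_radius0 (X : 'M[R]_0) : rho X = 0.
Proof.
rewrite /spectral_radius; set E := (X in sup X).
suff -> : E = classical_sets.set0 by rewrite sup0.
apply/seteqP; split=> // x [z /= /eigenvalueP[v _ v0] _].
by case/negP: v0; rewrite (thinmx0 v).
Qed.

Lemma spectral_radiusP n (X : 'M[R]_n) : (0 < n)%N -> nneg_mx X ->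
  [/\ 0 <= rho X, root (char_poly X) (rho X) &
      forall s, rho X < s -> 0 < (char_poly X).[s]].
Proof.
move=> n_gt0 X0; have [a [a0 pa pX]] := perron_root n_gt0 X0.
by rewrite (spectral_radius_root X0 a0 pa pX).
Qed.

Lemma spectral_radius_ge0 n (X : 'M[R]_n) : nneg_mx X -> 0 <= rho X.
Proof.
case: n X => [|n] X X0; first by rewrite spectral_radius0.
by have [] := spectral_radiusP (ltn0Sn n) X0.
Qed.

Lemma root_le_spectral_radius n (X : 'M[R]_n) t : nneg_mx X ->
  root (char_poly X) t -> t <= rho X.
Proof.
case: n X => [|n] X X0 pt.
  by move: pt; rewrite /root horner_char_poly det_mx00 oner_eq0.
have [_ _ pX] := spectral_radiusP (ltn0Sn n) X0.
by rewrite leNgt; apply/negP => /pX; rewrite (rootP pt) ltxx.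
Qed.

Lemma spectral_radius_tr n (X : 'M[R]_n) : nneg_mx X -> rho X^T = rho X.
Proof.
case: n X => [|n] X X0; first by rewrite !spectral_radius0.
have [? ? ?] := spectral_radiusP (ltn0Sn n) X0.
by apply: spectral_radius_root; rewrite ?char_poly_tr //; apply: nneg_tr.
Qed.

Lemma leading_exists n (X : 'M[R]_n) : (0 < n)%N -> nneg_mx X ->
  exists v, leading_eigenvector X v.
Proof.
move=> n_gt0 X0; have [a0 pa pX] := spectral_radiusP n_gt0 X0.
by have [x [x0 ? ?]] := perron_vector X0 a0 pa pX; exists x.
Qed.

Lemma leading_nneg n (X : 'M[R]_n) v : leading_eigenvector X v -> nneg_mx v.
Proof. by case=> _ v0 _ i j; rewrite ord1. Qed.

Lemma left_leading n (X : 'M[R]_n) z : nneg_mx X ->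
  leading_eigenvector X^T z <-> [/\ z != 0, nneg_mx z & X^T *m z = rho X *: z].
Proof.
move=> X0; rewrite -(spectral_radius_tr X0).
by split=> [[? z0 ?]|[? z0 ?]]; split=> // i j; rewrite ord1.
Qed.

Lemma subinvariant_le n (X : 'M[R]_n) c (x : 'cV[R]_n) :
    nneg_mx X -> nneg_mx x -> x != 0 -> (forall i, c * x i 0 <= (X *m x) i 0) ->
  c <= rho X.
Proof.
case: n X x => [|n] X x X0 x0 x_neq0 Xx.
  by case/negP: x_neq0; rewrite (flatmx0 x).
have [_ _ pX] := spectral_radiusP (ltn0Sn n) X0.
rewrite leNgt; apply/negP => c_gt.
have : c < c; last by rewrite ltxx.
apply: (subinvariant_lt X0 _ x0 x_neq0 Xx) => s cs.
by apply: pX; apply: lt_le_trans cs.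
Qed.

Lemma superinvariant_ge n (X : 'M[R]_n) c (v : 'cV[R]_n) : (0 < n)%N ->
    nneg_mx X -> (forall i, 0 < v i 0) -> (forall i, (X *m v) i 0 <= c * v i 0) ->
  rho X <= c.
Proof.
move=> n_gt0 X0 v0 Xv.
have [z] := leading_exists n_gt0 (nneg_tr X0).
case/(left_leading z X0) => z_neq0 z0 zX.
have := dot_tr X z v; rewrite zX [in RHS]dotC dotZr [in RHS]dotC => zXv.
have : dot z (X *m v) <= dot z (c *: v).
  by apply: ler_dot => // i; rewrite mx_scaleE.
by rewrite zXv dotZr ler_pM2r // dot_gt0.
Qed.

End PerronFrobenius.

(** * Simple eigenvalues *)

Section LeftRight.
Variables (R : realType) (n : nat).
Implicit Types (M : 'M[R]_n) (u v z w : 'cV[R]_n) (a : R).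

(** The left and right eigenspaces of an eigenvalue have the same dimension. *)
Lemma left_eigen_unique M a v u z :
    (forall w, M *m w = a *: w -> exists c, w = c *: v) ->
    u != 0 -> M^T *m u = a *: u -> M^T *m z = a *: z ->
  exists c, z = c *: u.
Proof.
move=> right_unique u0 uM zM; pose K := M - a%:M.
have kerP x : M^T *m x = a *: x -> (x^T <= kermx K)%MS.
  move=> xM; apply/sub_kermxP; rewrite mulmxBr mul_mx_scalar.
  by rewrite -[M]trmxK -trmx_mul xM linearZ /= subrr.
have rK : (\rank (kermx K^T) <= 1)%N.
  apply: leq_trans (rank_leq_row v^T); apply/mxrankS/row_subP => i.
  have [c cE] : exists c, (row i (kermx K^T))^T = c *: v.
    apply: right_unique; apply/eqP; rewrite -subr_eq0 -mul_scalar_mx -mulmxBl -/K.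
    rewrite -{1}[K]trmxK -trmx_mul -row_mul mulmx_ker.
    by apply/eqP/matrixP => k l; rewrite !mxE.
  by apply/sub_rVP; exists c; rewrite -linearZ /= -cE trmxK.
have le_u : (u^T <= kermx K)%MS by apply: kerP.
have ru : \rank u^T = 1%N by rewrite rank_rV -trmx0 (inj_eq trmx_inj) u0.
have : (kermx K <= u^T)%MS.
  rewrite -(geq_leqif (mxrank_leqif_sup le_u)) ru.
  by move: rK; rewrite !mxrank_ker mxrank_tr.
move=> /(submx_trans (kerP _ _ zM))/sub_rVP[c cE].
by exists c; apply: trmx_inj; rewrite cE linearZ.
Qed.

End LeftRight.

Lemma char_poly_conj (R : fieldType) n (P M N : 'M[R]_n) :
  P \in unitmx -> P *m M = N *m P -> char_poly M = char_poly N.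
Proof.
move=> P_unit PM; pose Q := map_mx polyC P.
have Q0 : \det Q != 0.
  by rewrite det_map_mx polyC_eq0 -unitfE -unitmxE.
apply: (mulfI Q0); rewrite [RHS]mulrC -!det_mulmx; congr (\det _).
rewrite mulmxBr mulmxBl mul_mx_scalar mul_scalar_mx; congr (_ - _).
by rewrite -!map_mxM /= PM.
Qed.

(** Completing [u] to a basis splits the factor ['X - a] off the characteristic
    polynomial; a further root [a] of the cofactor would yield a second
    eigenvector or a Jordan chain ending at [u]. *)
Lemma simple_eigenvalue (R : fieldType) n (M : 'M[R]_n) a (u : 'cV[R]_n) :
    u != 0 -> M^T *m u = a *: u ->
    (forall z, M^T *m z = a *: z -> exists c, z = c *: u) ->
    (forall z c, M^T *m z = a *: z + c *: u -> c = 0) ->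
  mup a (char_poly M) = 1%N.
Proof.
case: n M u => [|n] M u u0 uM eig_unique no_chain.
  by case/negP: u0; rewrite (flatmx0 u).
pose e0 : 'rV[R]_n.+1 := delta_mx 0 0.
have [P P_unit e0P] : exists2 P, P \in unitmx & e0 *m P = u^T.
  have e0f : e0 *m (\matrix_(i < n.+1) u^T) = u^T.
    by rewrite -rowE rowK.
  have [|P P_unit eP] := @complete_unitmx _ _ _ e0 (\matrix_(i < n.+1) u^T).
    by rewrite e0f mxrank_delta rank_rV -trmx0 (inj_eq trmx_inj) u0.
  by exists P; rewrite // -eP.
have uM' : u^T *m M = a *: u^T by rewrite -[M]trmxK -trmx_mul uM linearZ.
have [N NP e0N] : exists2 N : 'M_(1 + n), P *m M = N *m P & e0 *m N = a *: e0.
  exists (P *m M *m invmx P); first by rewrite mulmxKV.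
  by rewrite !mulmxA e0P uM' -e0P -scalemxAl -mulmxA mulmxV // mulmx1.
have N_def : N = block_mx a%:M 0 (dlsubmx N) (drsubmx N).
  have row0 (j : 'I_n.+1) : N 0 j = a *+ (j == 0).
    by have /rowP/(_ j) := e0N; rewrite -rowE !mxE eqxx /= mulr_natr.
  rewrite -[LHS]submxK; congr block_mx; apply/matrixP => i j; rewrite !ord1 !mxE.
    by rewrite -[RHS](row0 (lshift n 0 : 'I_(1 + n))); congr (N _ _); apply: val_inj.
  by rewrite -[RHS](row0 (rshift 1 j : 'I_(1 + n))); congr (N _ _); apply: val_inj.
have pM : char_poly M = ('X - a%:P) * char_poly (drsubmx N).
  have := char_poly_lblock a%:M (dlsubmx N) (drsubmx N); rewrite -N_def.
  move=> pN; apply: etrans (char_poly_conj P_unit NP) (etrans pN _).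
  by congr (_ * _); rewrite /char_poly det_mx11 !mxE eqxx !mulr1n.
rewrite pM; suff nroot : ~~ root (char_poly (drsubmx N)) a.
  by rewrite mupMl // -['X - _]expr1 mup_XsubCX eqxx.
rewrite -eigenvalue_root_char; apply/negP => /eigenvalueP[c cN c0].
pose y : 'rV[R]_(1 + n) := row_mx 0 c; pose k := (c *m dlsubmx N) 0 0.
have ke0 t : t *: e0 = row_mx (t *: 1 : 'M_1) (0 : 'rV_n).
  apply/rowP => j; case: (split_ordP (j : 'I_(1 + n))) => l ->.
    by rewrite (row_mxEl (t *: 1 : 'M_1) 0) !mxE !ord1.
  by rewrite (row_mxEr (t *: 1 : 'M_1) 0) !mxE mulr0.
have yN : y *m N = a *: y + k *: e0.
  have -> : a *: y + k *: e0 = row_mx (a *: 0 + k *: 1) (a *: c + 0).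
    by rewrite ke0 /y scale_row_mx; apply: add_row_mx.
  rewrite {1}N_def mul_row_block !mul0mx !add0r scaler0 addr0 add0r cN.
  by congr row_mx; apply/matrixP => i j; rewrite !ord1 !entryE [X in _ * X]mxE mulr1.
pose z : 'cV[R]_n.+1 := (y *m P)^T.
have zM : M^T *m z = a *: z + k *: u.
  rewrite -trmx_mul -mulmxA NP mulmxA yN mulmxDl -!scalemxAl e0P.
  by rewrite linearD !linearZ /= trmxK.
have k0 := no_chain _ _ zM; rewrite k0 scale0r addr0 in zM.
have [d zE] := eig_unique z zM.
have : y = d *: e0.
  have : y *m P = d *: e0 *m P.
    by rewrite -scalemxAl e0P -linearZ /= -zE trmxK.
  by move/(congr1 (mulmx^~ (invmx P))); rewrite !mulmxK.
rewrite ke0 => /eq_row_mx[_ c_eq0].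
by rewrite c_eq0 eqxx in c0.
Qed.

(** * Lowering rows against the leading eigenvector *)

Lemma exists_max (R : realType) (I : finType) (P : pred I) (F : I -> R) i0 :
  P i0 -> exists2 i, P i & forall j, P j -> F j <= F i.
Proof. by move=> Pi0; case: (arg_maxP F Pi0) => i Pi Fi; exists i. Qed.

Section RightUnique.
Variables (R : realType) (n : nat) (X : 'M[R]_n) (v : 'cV[R]_n).
Hypotheses (v_min : minimal_leading X v) (v_gt0 : forall i, 0 < v i 0).
Local Notation rho := (spectral_radius X).

(** The least multiple of [v] above [w] minus [w] is a nonnegative eigenvector
    with a zero entry, so it vanishes by minimality of the support of [v]. *)
Lemma right_unique w : X *m w = rho *: w -> exists c, w = c *: v.
Proof.
move=> Xw; have [[/cV_neq0[i0 _] _ Xv] v_supp] := v_min.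
have [h _ maxh] := @exists_max R _ predT (fun i => w i 0 / v i 0) i0 isT.
pose c := w h 0 / v h 0; exists c; pose d := c *: v - w.
suff d0 : d = 0 by apply/esym/eqP; rewrite -subr_eq0 -/d d0.
apply/eqP; apply: contraT => d_neq0.
have d_ge0 i : 0 <= d i 0.
  by rewrite !entryE subr_ge0 -ler_pdivrMr // maxh.
have dh : d h 0 = 0 by rewrite !entryE divfK ?subrr // gt_eqF.
have d_lead : leading_eigenvector X d.
  by split=> //; rewrite mulmxBr -scalemxAr Xw Xv scalerBr !scalerA mulrC.
case/negP: (v_supp _ d_lead); rewrite properE; apply/andP; split.
  by apply/subsetP => i _; rewrite inE gt_eqF.
by apply/subsetPn; exists h; [rewrite inE gt_eqF | rewrite inE dh eqxx].
Qed.

Lemma leading_unique w : leading_eigenvector X w -> exists2 c, 0 < c & w = c *: v.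
Proof.
case=> w_neq0 w0 /right_unique[c wE]; exists c => //.
have [i wi] := cV_neq0 w_neq0; have : 0 < w i 0 by rewrite lt_neqAle eq_sym wi w0.
by rewrite wE entryE pmulr_lgt0.
Qed.

End RightUnique.

Section Lowering.
Variables (R : realType) (n : nat) (X Y : 'M[R]_n) (v u : 'cV[R]_n).
Implicit Types (z w e : 'cV[R]_n).
Local Notation rho := (spectral_radius X).
Hypotheses (X0 : nneg_mx X) (Y0 : nneg_mx Y).
Hypotheses (v_min : minimal_leading X v) (v_gt0 : forall i, 0 < v i 0).
Hypothesis Yv_le : forall i, (Y *m v) i 0 <= rho * v i 0.
Hypothesis Yv_eq : forall i, (Y *m v) i 0 = rho * v i 0 -> row i Y = row i X.
Hypotheses (u_neq0 : u != 0) (u0 : nneg_mx u) (uX : X^T *m u = rho *: u).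

Let n_gt0 : (0 < n)%N.
Proof. by have [i _] := cV_neq0 u_neq0; apply: leq_trans (ltn_ord i). Qed.

Lemma left_unique z : X^T *m z = rho *: z -> exists c, z = c *: u.
Proof. exact: left_eigen_unique (right_unique v_min v_gt0) u_neq0 uX. Qed.

Lemma lowered_radius_le : spectral_radius Y <= rho.
Proof. exact: superinvariant_ge Yv_le. Qed.

Lemma left_agree z : (forall i, z i 0 != 0 -> row i Y = row i X) ->
  X^T *m z = Y^T *m z.
Proof.
move=> YX; apply/matrixP => j k; rewrite !mxE; apply: eq_bigr => i _; rewrite ord1.
have [->|/YX/rowP/(_ j)] := eqVneq (z i 0) 0; first by rewrite !mulr0.
by rewrite !mxE => ->.
Qed.

(** Pairing with [v] gives [rho (z, v) <= (z, Y v) <= rho (z, v)], so equality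
    holds entrywise: [z] lives on the rows that were not lowered. *)
Lemma left_subinvariant z : nneg_mx z ->
    (forall j, rho * z j 0 <= (Y^T *m z) j 0) ->
  [/\ Y^T *m z = rho *: z, X^T *m z = rho *: z &
      forall i, z i 0 != 0 -> (Y *m v) i 0 = rho * v i 0].
Proof.
move=> z0 zY; have v0 : nneg_mx v by move=> i j; rewrite ord1 ltW.
have le1 : dot z (Y *m v) <= dot z (rho *: v).
  by apply: ler_dot => // i; rewrite entryE.
have le2 : dot v (rho *: z) <= dot v (Y^T *m z).
  by apply: ler_dot => // i; rewrite entryE.
have eq1 : dot z (rho *: v) = dot v (rho *: z) by rewrite !dotZr dotC.
have eq2 : dot z (Y *m v) = dot v (Y^T *m z) by rewrite dot_tr dotC.
have Yz i : z i 0 != 0 -> (Y *m v) i 0 = rho * v i 0.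
  move=> zi; rewrite -entryE; apply: (dot_eq z0) zi => [k|].
    by rewrite entryE.
  by rewrite eq1 eq2.
have YzE : Y^T *m z = rho *: z.
  apply/matrixP => i j; rewrite ord1; apply/esym.
  apply: (dot_eq v0) (lt0r_neq0 (v_gt0 i)) => [k|]; first by rewrite entryE.
  by rewrite -eq1 -eq2.
split=> //; rewrite left_agree // => i zi; exact/Yv_eq/Yz.
Qed.

Lemma left_eigen_lowered z : Y^T *m z = rho *: z ->
  X^T *m z = rho *: z /\ forall i, z i 0 != 0 -> (Y *m v) i 0 = rho * v i 0.
Proof.
move=> zY; pose y : 'cV[R]_n := \col_i `|z i 0|.
have [||_ _ Yy] := left_subinvariant (z := y).
- by move=> i j; rewrite mxE.
- move=> j; have rho0 := spectral_radius_ge0 X0.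
  rewrite [y j 0]mxE -(ger0_norm rho0) -normrM -entryE -zY !mxE.
  apply: le_trans (ler_norm_sum _ _ _) _; apply: ler_sum => i _.
  by rewrite !mxE normrM (ger0_norm (Y0 _ _)).
have Yz i : z i 0 != 0 -> (Y *m v) i 0 = rho * v i 0.
  by move=> zi; apply: Yy; rewrite mxE normr_eq0.
by split=> //; rewrite left_agree // => i zi; apply/Yv_eq/Yz.
Qed.

Section BasicRowsKept.
Hypothesis u_eq : forall i, u i 0 != 0 -> (Y *m v) i 0 = rho * v i 0.

Let uY : Y^T *m u = rho *: u.
Proof. by rewrite -left_agree // => i /u_eq/Yv_eq. Qed.

Lemma lowered_radius_eq : spectral_radius Y = rho.
Proof.
apply/le_anti/andP; split; first exact: lowered_radius_le.
rewrite -(spectral_radius_tr Y0).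
apply: (subinvariant_le (nneg_tr Y0) u0 u_neq0) => i.
by rewrite uY entryE.
Qed.

Lemma lowered_left_unique z : Y^T *m z = rho *: z -> exists c, z = c *: u.
Proof. by case/left_eigen_lowered => /left_unique. Qed.

(** A chain [z] above [u] can be shifted along [u] until it is positive at an
    entry of [u]; there its positive part, an eigenvector, would grow
    strictly. *)
Lemma lowered_no_chain z c : Y^T *m z = rho *: z + c *: u -> c = 0.
Proof.
have no_pos z1 c1 : 0 < c1 -> Y^T *m z1 <> rho *: z1 + c1 *: u.
  move=> c_gt0 zY; have [h uh] := cV_neq0 u_neq0.
  have uh_gt0 : 0 < u h 0 by rewrite lt_neqAle eq_sym uh u0.
  pose y := z1 + ((1 - z1 h 0) / u h 0) *: u.
  have yh : y h 0 = 1 by rewrite !entryE divfK // addrC subrK.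
  have yY : Y^T *m y = rho *: y + c1 *: u.
    rewrite mulmxDr zY -scalemxAr uY scalerDr !scalerA -!addrA; congr (_ + _).
    by rewrite addrC mulrC.
  pose p : 'cV[R]_n := \col_i Num.max (y i 0) 0.
  have p0 : nneg_mx p by move=> i j; rewrite mxE le_max lexx orbT.
  have yp i : y i 0 <= p i 0 by rewrite [leRHS]mxE le_max lexx.
  have Yyp j : (Y^T *m y) j 0 <= (Y^T *m p) j 0.
    rewrite [leLHS]mxE [leRHS]mxE ler_sum // => i _.
    by apply: ler_wpM2l => //; rewrite mxE.
  have [|pY _ _] := left_subinvariant (z := p) p0.
    move=> j; rewrite [p j 0]mxE /Num.max; case: ifP => _.
      by rewrite mulr0 nneg_mul //; apply: nneg_tr.
    apply: le_trans (Yyp j); rewrite yY !entryE lerDl mulr_ge0 ?u0 //.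
    exact: ltW.
  have yYh : (Y^T *m y) h 0 = rho * 1 + c1 * u h 0.
    by rewrite yY mx_addE !mx_scaleE yh.
  have ph : p h 0 = 1 by rewrite mxE yh (max_idPl ler01).
  have := Yyp h; rewrite pY yYh mx_scaleE ph.
  by rewrite gerDl leNgt mulr_gt0.
move=> zY; case: (ltgtP c 0) => // c_sgn.
  case: (no_pos (- z) (- c)); first by rewrite oppr_gt0.
  by rewrite mulmxN zY opprD scalerN scaleNr.
by case: (no_pos z c).
Qed.

Lemma lowered_simple : leading_simple Y.
Proof.
rewrite /leading_simple lowered_radius_eq.
exact: simple_eigenvalue u_neq0 uY lowered_left_unique lowered_no_chain.
Qed.

(** Otherwise [M], which is [Y] with the rows and columns in the support of [u]
    cleared, would have spectral radius at least [rho].  A left eigenvector of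
    [M] would then be one of [Y], hence a multiple of [u], although it vanishes on
    the support of [u]. *)
Lemma subinvariant_off_basic e : 0 < rho -> nneg_mx e ->
    (forall i, u i 0 != 0 -> e i 0 = 0) ->
    (forall i, rho * e i 0 <= (Y *m e) i 0) ->
  e = 0.
Proof.
move=> rho_gt0 e0 eH eY; apply/eqP; apply: contraT => e_neq0.
pose M : 'M[R]_n :=
  \matrix_(i, j) if (u i 0 == 0) && (u j 0 == 0) then Y i j else 0.
have M0 : nneg_mx M by move=> i j; rewrite mxE; case: ifP.
have MY i j : M i j <= Y i j by rewrite mxE; case: ifP.
have rho_le : rho <= spectral_radius M.
  apply: (subinvariant_le M0 e0 e_neq0) => i.
  have [ui|/eH ->] := eqVneq (u i 0) 0; last first.
    by rewrite mulr0 nneg_mul.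
  apply: le_trans (eY i) _; rewrite !mxE ler_sum // => j _.
  rewrite mxE ui eqxx /=; case: eqVneq => [//|/eH ->].
  by rewrite !mulr0.
have [z] := leading_exists n_gt0 (nneg_tr M0).
case/(left_leading z M0) => z_neq0 z0 zM.
have Mz j : (M^T *m z) j 0 <= (Y^T *m z) j 0.
  rewrite [leLHS]mxE [leRHS]mxE ler_sum // => i _.
  by apply: ler_wpM2r => //; rewrite [leLHS]mxE [leRHS]mxE.
have [j|_ /left_unique[c zE] _] := left_subinvariant z0.
  apply: le_trans (Mz j); rewrite zM entryE.
  by apply: ler_wpM2r.
have [h uh] := cV_neq0 u_neq0; have : (M^T *m z) h 0 = 0.
  by rewrite !mxE big1 // => i _; rewrite !mxE (negPf uh) andbF mul0r.
rewrite zM entryE => /eqP; rewrite mulf_eq0 gt_eqF ?(lt_le_trans rho_gt0) //=.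
rewrite zE entryE mulf_eq0 (negPf uh) orbF => /eqP c0.
by case/negP: z_neq0; rewrite zE c0 scale0r.
Qed.

(** Scale [v] by the least [c] with [w <= c v] on the support of [u].  Off that
    support [w <= c v] follows from [subinvariant_off_basic].  The support of [u]
    cannot contain both zeros and nonzeros of [d = c v - w]: the restriction of
    [u] to the zeros of [d] is again a left eigenvector. *)
Lemma lowered_progress w : 0 < rho -> leading_eigenvector Y w ->
    ~ (forall i, (Y *m v) i 0 = rho * v i 0) ->
  exists c : R, [/\ 0 < c, forall i, w i 0 <= c * v i 0,
                forall i, u i 0 != 0 -> w i 0 = c * v i 0 & w <> c *: v].
Proof.
move=> rho_gt0 [w_neq0 w0]; rewrite lowered_radius_eq => wY Y_neq.
have [i0 ui0] := cV_neq0 u_neq0.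
have [h uh maxh] := @exists_max R _ [pred i | u i 0 != 0]
  (fun i => w i 0 / v i 0) i0 ui0.
pose c := w h 0 / v h 0; pose d := c *: v - w.
have c_ge0 : 0 <= c by rewrite divr_ge0 // ltW.
have dE i : d i 0 = c * v i 0 - w i 0 by rewrite !entryE.
have dh : d h 0 = 0 by rewrite dE divfK ?subrr // gt_eqF.
have d_ge0u i : u i 0 != 0 -> 0 <= d i 0.
  by move=> ui; rewrite dE subr_ge0 -ler_pdivrMr // maxh.
have Yd i : (Y *m d) i 0 <= rho * d i 0.
  rewrite mulmxBr -scalemxAr wY !entryE mulrBr lerD2r mulrCA.
  exact: ler_wpM2l.
pose e : 'cV[R]_n := \col_i Num.max (- d i 0) 0.
have e_ge i : - d i 0 <= e i 0 by rewrite [leRHS]mxE le_max lexx.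
have e0 : e = 0.
  apply: subinvariant_off_basic => //.
  - by move=> i j; rewrite mxE le_max lexx orbT.
  - by move=> i ui; rewrite mxE max_r // oppr_le0 d_ge0u.
  move=> i; rewrite [e i 0]mxE /Num.max; case: ifP => _.
    by rewrite mulr0 nneg_mul // => k j; rewrite mxE le_max lexx orbT.
  rewrite mulrN; apply: (@le_trans _ _ (- (Y *m d) i 0)); first by rewrite lerN2.
  by rewrite !mxE -sumrN ler_sum // => j _; rewrite -mulrN ler_wpM2l.
have d_ge0 i : 0 <= d i 0.
  by have := e_ge i; rewrite e0 [X in _ <= X]mxE oppr_le0.
have c_gt0 : 0 < c.
  rewrite lt_neqAle c_ge0 andbT; apply: contraNneq w_neq0 => c0.
  apply/eqP/matrixP => i j; rewrite ord1 mxE; apply/eqP.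
  by rewrite eq_le w0 andbT; have := d_ge0 i; rewrite dE -c0 mul0r sub0r oppr_ge0.
clearbody d; exists c; split=> //.
- by move=> i; have := d_ge0 i; rewrite dE subr_ge0.
- pose z : 'cV[R]_n := \col_i if d i 0 == 0 then u i 0 else 0.
  have z0 : nneg_mx z by move=> i j; rewrite mxE; case: ifP.
  have zu i : z i 0 != 0 -> d i 0 = 0 /\ u i 0 != 0.
    by rewrite mxE; case: (eqVneq (d i 0) 0) => [di ui|]; rewrite ?eqxx.
  have zY j : (Y^T *m z) j 0 <= rho * z j 0.
    rewrite [z j 0]mxE; case: eqVneq => [_|dj].
      have /matrixP/(_ j 0) := uY; rewrite [RHS]entryE => <-.
      rewrite !mxE ler_sum // => i _; rewrite ler_wpM2l ?mxE //.
      by case: ifP.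
    rewrite mulr0 mxE big1 // => i _; rewrite mxE.
    have [->|/zu[di _]] := eqVneq (z i 0) 0; first by rewrite mulr0.
    have : Y i j * d j 0 <= 0.
      have := Yd i; rewrite di mulr0 mxE (bigD1 j) //=.
      by apply: le_trans; rewrite lerDl sumr_ge0 // => k _; rewrite mulr_ge0.
    rewrite pmulr_lle0; last by rewrite lt_neqAle eq_sym dj d_ge0.
    by move=> Yij; rewrite (_ : Y i j = 0) ?mul0r //; apply/eqP; rewrite eq_le Yij Y0.
  have v0 : nneg_mx v by move=> i j; rewrite ord1 ltW.
  have zYE : Y^T *m z = rho *: z.
    apply/matrixP => i j; rewrite ord1.
    apply: (dot_eq v0) (lt0r_neq0 (v_gt0 i)) => [k|]; first by rewrite entryE.
    rewrite [leRHS]dotC -dot_tr dotZr -dotC -dotZr le_eqVlt; apply/orP; left.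
    apply/eqP/eq_bigr => k _; rewrite entryE.
    have [->|/zu[_ uk]] := eqVneq (z k 0) 0; first by rewrite !mul0r.
    by rewrite u_eq.
  have [a zE] := lowered_left_unique zYE.
  have a_neq0 : a != 0.
    have /matrixP/(_ h 0) := zE; rewrite !mxE dh eqxx => uha.
    by apply: contraNneq uh => a0; rewrite uha a0 mul0r.
  move=> i ui; apply/esym/eqP; rewrite -subr_eq0 -dE.
  suff /zu[-> _] : z i 0 != 0 by [].
  by rewrite zE entryE mulf_neq0.
move=> wE; apply: Y_neq => i; have /matrixP/(_ i 0) := wY.
rewrite wE -scalemxAr !entryE mulrCA; apply: mulfI; exact: lt0r_neq0.
Qed.

End BasicRowsKept.

Lemma lowered_radius_lt : ~ (forall i, u i 0 != 0 -> (Y *m v) i 0 = rho * v i 0) ->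
  spectral_radius Y < rho.
Proof.
move=> u_neq; rewrite lt_neqAle lowered_radius_le andbT.
apply/negP => /eqP rhoY; apply: u_neq.
have [z] := leading_exists n_gt0 (nneg_tr Y0).
case/(left_leading z Y0) => z_neq0 z0; rewrite rhoY.
case/left_eigen_lowered => /left_unique[c zE] Yz i ui; apply: Yz.
have c_neq0 : c != 0.
  by apply: contraNneq z_neq0 => c0; rewrite zE c0 scale0r.
rewrite zE mx_scaleE; exact: mulf_neq0.
Qed.

End Lowering.

(** * Minimal rows *)

Section Rows.
Variables (R : realType) (n : nat) (a : 'rV[R]_n) (r : nat) (v : 'cV[R]_n).
Hypothesis a_bool : boolean_mx a.
Implicit Types x : 'rV[R]_n.

Local Notation D := (supp a^T).
Local Notation zeros x := [set j in D | x 0 j == 0].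

Lemma mem_suppr j : (j \in D) = (a 0 j != 0).
Proof. by rewrite inE mxE. Qed.

Lemma bool_row_supp j : a 0 j = (j \in D)%:R.
Proof. by rewrite mem_suppr; case: (a_bool 0 j) => ->; rewrite ?eqxx ?oner_eq0. Qed.

Lemma bool_subrow x j : boolean_mx x -> (forall j, j \notin D -> x 0 j = 0) ->
  x 0 j = (j \in D :\: zeros x)%:R.
Proof.
move=> x_bool xD; rewrite in_setD in_set; have [jD|/xD ->] := boolP (j \in D).
  by case: (x_bool 0 j) => ->; rewrite ?eqxx ?oner_eq0.
by rewrite andbF.
Qed.

Lemma sum_indicator (A : {set 'I_n}) : \sum_j (j \in A)%:R = #|A|%:R :> R.
Proof.
rewrite -sum1_card natr_sum [RHS]big_mkcond /=.
by apply: eq_bigr => j _; case: ifP.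
Qed.

Lemma dist_subrow x : boolean_mx x -> (forall j, j \notin D -> x 0 j = 0) ->
  \sum_j `|a 0 j - x 0 j| = #|zeros x|%:R.
Proof.
move=> x_bool xD; rewrite -sum_indicator.
apply: eq_bigr => j _; rewrite bool_row_supp (bool_subrow j x_bool xD).
rewrite in_setD; case: (boolP (j \in zeros x)) => /=.
  by rewrite in_set => /andP[-> _]; rewrite subr0 normr1.
by rewrite subrr normr0.
Qed.

Lemma top_subset (A : {set 'I_n}) m : (m <= #|A|)%N ->
  exists J : {set 'I_n}, [/\ J \subset A, #|J| = m &
    forall j k, j \in J -> k \in A :\: J -> v k 0 <= v j 0].
Proof.
elim: m => [|m IHm] mA.
  by exists set0; split; rewrite ?sub0set ?cards0 // => j k; rewrite inE.
have [J [JA Jm Jtop]] := IHm (ltnW mA).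
have /set0Pn[k0 k0A] : A :\: J != set0.
  by rewrite -card_gt0 cardsD (setIidPr JA) Jm subn_gt0.
have [h hA maxh] := exists_max (P := mem (A :\: J)) (fun k => v k 0) k0A.
have [hJ hA'] : h \notin J /\ h \in A by apply/andP; rewrite -in_setD.
exists (h |: J); split.
- by apply/fintype.subsetP => j; rewrite in_setU1 => /orP[/eqP ->|/(fintype.subsetP JA)].
- by rewrite cardsU1 hJ Jm.
move=> j k jJ; rewrite in_setD in_setU1 negb_or => /andP[/andP[_ kJ] kA].
have kAJ : k \in A :\: J by rewrite in_setD kJ.
by move: jJ; rewrite in_setU1 => /orP[/eqP ->|jJ]; [apply: maxh | apply: Jtop].
Qed.

Lemma minimal_row_exists : exists x, minimal_row a r v x.
Proof.
have [J [JD Jm Jtop]] := top_subset (geq_minr r #|D|).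
pose x : 'rV[R]_n := \row_j (j \in D :\: J)%:R.
have x_bool : boolean_mx x.
  by move=> i j; rewrite mxE; case: (_ \in _); [right | left].
have xD j : j \notin D -> x 0 j = 0.
  by move=> jD; rewrite mxE in_setD (negPf jD) andbF.
have zeros_x : zeros x = J.
  apply/setP => j; rewrite in_set mxE in_setD.
  have [/(fintype.subsetP JD) ->|_] := boolP (j \in J); first by rewrite eqxx.
  by case: (j \in D); rewrite ?oner_eq0.
exists x; split; rewrite ?zeros_x //; split.
  by move=> j; rewrite mxE ler0n.
by rewrite dist_subrow // zeros_x Jm ler_nat geq_minl.
Qed.

(** A price [t] separating the deleted entries of a minimal row from the kept
    ones; it is positive only if the whole budget [r] is spent. *)
Lemma minimal_row_threshold x : minimal_row a r v x -> (forall j, 0 <= v j 0) ->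
  exists t, [/\ 0 <= t, forall j, j \in zeros x -> t <= v j 0,
    forall k, k \in D :\: zeros x -> v k 0 <= t & t * r%:R = t * #|zeros x|%:R].
Proof.
case=> _ _ _ card_x top_x v0.
have [K0|/set0Pn[k0 k0K]] := eqVneq (D :\: zeros x) set0.
  by exists 0; split; rewrite ?mul0r // => k; rewrite K0 in_set0.
have [h hK maxh] := exists_max (P := mem (D :\: zeros x)) (fun k => v k 0) k0K.
have {}hK : h \in D :\: zeros x by [].
exists (v h 0); split=> // [j jx|]; first exact: top_x.
congr (_ * _%:R); rewrite card_x; apply/esym/minn_idPl.
have : (#|zeros x| < #|D|)%N.
  apply: proper_card; rewrite properE; apply/andP; split.
    by apply/fintype.subsetP => j; rewrite in_set => /andP[].
  apply/subsetPn; exists h; first by move: hK; rewrite in_setD => /andP[].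
  by move: hK; rewrite in_setD => /andP[].
by rewrite card_x gtn_min ltnn orbF => /ltnW.
Qed.

(** With [t] the price of a unit of distance from [a], lowering a kept entry
    gains at most the price paid, and restoring a deleted entry costs at least
    the price refunded. *)
Lemma minimal_row_gap x x0 t j : row_ball a r x -> minimal_row a r v x0 ->
    (forall j, 0 <= v j 0) -> 0 <= t ->
    (forall j, j \in zeros x0 -> t <= v j 0) ->
    (forall k, k \in D :\: zeros x0 -> v k 0 <= t) ->
  t * ((j \in zeros x0)%:R - `|a 0 j - x 0 j|) <= (x 0 j - x0 0 j) * v j 0.
Proof.
move=> [x_ge0 _] [x0_bool _ x0D _ _] v0 t0 tJ tK.
rewrite (bool_subrow j x0_bool x0D) bool_row_supp in_setD.
have [jJ|jJ] := boolP (j \in zeros x0) => /=.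
  have -> : j \in D by move: jJ; rewrite in_set => /andP[].
  set y := `| _ |; have y_ge : 1 - x 0 j <= y by apply: ler_norm.
  have vt : 0 <= v j 0 - t by rewrite subr_ge0 tJ.
  have yx : 0 <= y - (1 - x 0 j) by rewrite subr_ge0.
  by have := mulr_ge0 t0 yx; have := mulr_ge0 (x_ge0 j) vt; lra.
have [jD|jD] := boolP (j \in D) => /=.
  set y := `| _ |; have y_ge : 1 - x 0 j <= y by apply: ler_norm.
  have tv : 0 <= t - v j 0 by rewrite subr_ge0 tK // in_setD jJ.
  have yx : 0 <= y - (1 - x 0 j) by rewrite subr_ge0.
  have y0 : 0 <= y by apply: normr_ge0.
  by have := mulr_ge0 (v0 j) yx; have := mulr_ge0 y0 tv; lra.
have := mulr_ge0 (x_ge0 j) (v0 j); have := mulr_ge0 t0 (normr_ge0 (0 - x 0 j)).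
by set y := `| _ |; lra.
Qed.

Lemma minimal_row_cost x x0 t : row_ball a r x -> 0 <= t ->
    t * r%:R = t * #|zeros x0|%:R ->
  0 <= \sum_j t * ((j \in zeros x0)%:R - `|a 0 j - x 0 j|).
Proof.
move=> [_ x_le] t0 tr; rewrite -mulr_sumr sumrB mulrBr sum_indicator -tr.
rewrite -mulrBr mulr_ge0 // subr_ge0.
by [].
Qed.

(** The entrywise gaps add up, and the minimal row pays at least as much for its
    distance as any other row of the ball. *)
Lemma minimal_row_le x x0 : row_ball a r x -> minimal_row a r v x0 ->
    (forall j, 0 <= v j 0) ->
  \sum_j x0 0 j * v j 0 <= \sum_j x 0 j * v j 0.
Proof.
move=> x_ball x0_min v0; have [t [t0 tJ tK tr]] := minimal_row_threshold x0_min v0.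
rewrite -subr_ge0 -sumrB; apply: le_trans (minimal_row_cost x_ball t0 tr) _.
apply: ler_sum => j _; rewrite -mulrBl.
exact: minimal_row_gap.
Qed.

(** Equality makes every gap tight.  If [t = 0] then [x = x0]; otherwise the two
    rows delete equally many entries, and differ only where [v] equals [t]. *)
Lemma minimal_row_eq x x0 : boolean_mx x -> row_ball a r x ->
    (forall j, j \notin D -> x 0 j = 0) -> minimal_row a r v x0 ->
    (forall j, 0 < v j 0) ->
    \sum_j x 0 j * v j 0 = \sum_j x0 0 j * v j 0 ->
  minimal_row a r v x.
Proof.
move=> x_bool x_ball xD x0_min v_gt0 eq_sum.
have v0 j : 0 <= v j 0 by apply: ltW.
have [t [t0 tJ tK tr]] := minimal_row_threshold x0_min v0.
have [x0_bool _ x0D card_x0 _] := x0_min.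
have gap j := minimal_row_gap j x_ball x0_min v0 t0 tJ tK.
have cost0 := minimal_row_cost x_ball t0 tr.
have gap_sum : \sum_j (x 0 j - x0 0 j) * v j 0 = 0.
  under eq_bigr do rewrite mulrBl.
  by rewrite sumrB eq_sum subrr.
have tight j : t * ((j \in zeros x0)%:R - `|a 0 j - x 0 j|) =
    (x 0 j - x0 0 j) * v j 0.
  apply/eqP; rewrite eq_le gap /= -subr_le0.
  have : \sum_j ((x 0 j - x0 0 j) * v j 0 -
      t * ((j \in zeros x0)%:R - `|a 0 j - x 0 j|)) <= 0.
    by rewrite sumrB gap_sum sub0r oppr_le0.
  apply: le_trans; rewrite (bigD1 j) //= lerDl sumr_ge0 // => k _.
  by rewrite subr_ge0.
have dist_x j : `|a 0 j - x 0 j| = (j \in zeros x)%:R.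
  rewrite bool_row_supp (bool_subrow j x_bool xD) in_setD.
  case: (boolP (j \in zeros x)) => /=; last by rewrite subrr normr0.
  by rewrite in_set => /andP[-> _]; rewrite subr0 normr1.
have xE j : j \in D -> x 0 j = (j \notin zeros x)%:R.
  by move=> jD; rewrite (bool_subrow j x_bool xD) in_setD jD andbT.
have x0E j : j \in D -> x0 0 j = (j \notin zeros x0)%:R.
  by move=> jD; rewrite (bool_subrow j x0_bool x0D) in_setD jD andbT.
have [t_eq0|t_neq0] := eqVneq t 0.
  suff -> : x = x0 by [].
  apply/rowP => j; apply/eqP; rewrite -subr_eq0.
  have /esym/eqP := tight j; rewrite t_eq0 mul0r mulf_eq0 => /orP[//|].
  by rewrite gt_eqF.
have v_out j : j \in D -> (j \in zeros x) != (j \in zeros x0) -> v j 0 = t.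
  move=> jD; have := tight j; rewrite dist_x (xE j jD) (x0E j jD).
  by case: (_ \in zeros x); case: (_ \in zeros x0) => //= + _; lra.
split=> //.
  rewrite -card_x0; apply/eqP; rewrite -(eqr_nat R) -dist_subrow //.
  have : \sum_j t * ((j \in zeros x0)%:R - `|a 0 j - x 0 j|) = 0.
    by rewrite (eq_bigr _ (fun j _ => tight j)).
  move/eqP; rewrite -mulr_sumr mulf_eq0 (negPf t_neq0) /= sumrB sum_indicator.
  by rewrite subr_eq0 eq_sym.
move=> j k jJ; rewrite in_setD => /andP[kJ kD].
have jD : j \in D by move: jJ; rewrite in_set => /andP[].
apply: (@le_trans _ _ t).
  case: (boolP (k \in zeros x0)) => kJ0; last by apply: tK; rewrite in_setD kJ0.
  by rewrite (v_out k) // kJ0 (negPf kJ).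
case: (boolP (j \in zeros x0)) => jJ0; first exact: tJ.
by rewrite (v_out j) // jJ (negPf jJ0).
Qed.

End Rows.

(** * Principal submatrices *)

Section Restriction.
Variables (R : realType) (n : nat) (S : {set 'I_n}).
Implicit Types (X : 'M[R]_n) (v : 'cV[R]_n) (w : 'cV[R]_#|S|).

(** The sum has at most one term; it avoids choosing an index of ['I_#|S|] for the
    entries outside [S]. *)
Definition extend w : 'cV[R]_n := \col_j \sum_(k | enum_val k == j) w k 0.

Lemma extend_val w k : extend w (enum_val k) 0 = w k 0.
Proof. by rewrite mxE (big_pred1 k) // => l; rewrite (inj_eq enum_val_inj). Qed.

Lemma extend_out w j : j \notin S -> extend w j 0 = 0.
Proof.
move=> jS; rewrite mxE big_pred0 // => k; apply: contraNF jS => /eqP <-.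
exact: enum_valP.
Qed.

Lemma enum_val_onto j : j \in S -> exists k : 'I_#|S|, j = enum_val k.
Proof. by move=> jS; exists (enum_rank_in jS j); rewrite enum_rankK_in. Qed.

Lemma vec_restrE v k : vec_restr S v k 0 = v (enum_val k) 0.
Proof. by rewrite mxE. Qed.

Lemma mx_restrE X k l : mx_restr S X k l = X (enum_val k) (enum_val l).
Proof. by rewrite mxE. Qed.

Lemma vec_restr_extend w : vec_restr S (extend w) = w.
Proof. by apply/matrixP => k l; rewrite ord1 vec_restrE extend_val. Qed.

Lemma extend_restr v : (forall j, j \notin S -> v j 0 = 0) ->
  extend (vec_restr S v) = v.
Proof.
move=> vS; apply/matrixP => j l; rewrite ord1.
have [/enum_val_onto[k ->]|jS] := boolP (j \in S).
  by rewrite extend_val vec_restrE.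
by rewrite extend_out ?vS.
Qed.

Lemma vec_restrZ c v : vec_restr S (c *: v) = c *: vec_restr S v.
Proof. by apply/matrixP => k l; rewrite !mxE. Qed.

Lemma extendZ c w : extend (c *: w) = c *: extend w.
Proof.
apply/matrixP => j l; rewrite ord1 !mxE mulr_sumr.
by apply: eq_bigr => k _; rewrite mxE.
Qed.

Lemma mx_restr_tr X : (mx_restr S X)^T = mx_restr S X^T.
Proof. by apply/matrixP => k l; rewrite !mxE. Qed.

Lemma row_restrE X k : row_restr S (row (enum_val k) X) = row k (mx_restr S X).
Proof. by apply/rowP => l; rewrite !mxE. Qed.

Lemma nneg_mx_restr X : nneg_mx X -> nneg_mx (mx_restr S X).
Proof. by move=> X0 k l; rewrite mx_restrE. Qed.

Lemma nneg_vec_restr v : nneg_mx v -> nneg_mx (vec_restr S v).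
Proof. by move=> v0 k l; rewrite ord1 vec_restrE. Qed.

Lemma nneg_extend w : nneg_mx w -> nneg_mx (extend w).
Proof. by move=> w0 j l; rewrite mxE sumr_ge0. Qed.

Lemma sum_supported (F : 'I_n -> R) : (forall j, j \notin S -> F j = 0) ->
  \sum_j F j = \sum_(k < #|S|) F (enum_val k).
Proof.
move=> FS; rewrite -(big_enum_val F) [RHS]big_mkcond /=.
by apply: eq_bigr => j _; case: ifPn => // /FS.
Qed.

Lemma mul_restr X v : (forall j, j \notin S -> v j 0 = 0) ->
  mx_restr S X *m vec_restr S v = vec_restr S (X *m v).
Proof.
move=> vS; apply/matrixP => k l; rewrite ord1 vec_restrE !mxE.
rewrite (sum_supported (F := fun j => X (enum_val k) j * v j 0)).
  by apply: eq_bigr => j _; rewrite mx_restrE vec_restrE.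
by move=> j /vS ->; rewrite mulr0.
Qed.

Lemma supp_extend w : supp (extend w) = [set enum_val k | k in supp w].
Proof.
apply/setP => j; rewrite inE; apply/idP/imsetP => [jw|[k kw ->]].
  have [/enum_val_onto[k jk]|/extend_out w0] := boolP (j \in S).
    by exists k; rewrite // inE -extend_val -jk.
  by rewrite w0 eqxx in jw.
by move: kw; rewrite inE extend_val.
Qed.

Lemma extend_eq0 w : extend w = 0 -> w = 0.
Proof.
by move=> w0; apply/matrixP => k l; rewrite ord1 -extend_val w0 !mxE.
Qed.

Lemma restr_eq0 v : (forall j, j \notin S -> v j 0 = 0) -> vec_restr S v = 0 -> v = 0.
Proof.
move=> vS v0; rewrite -(extend_restr vS) v0.
by apply/matrixP => j l; rewrite !mxE big1 // => k _; rewrite mxE.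
Qed.

Definition inaccessible X := forall i j, i \notin S -> j \in S -> X i j = 0.

Lemma mul_extend X w : inaccessible X -> X *m extend w = extend (mx_restr S X *m w).
Proof.
move=> XS; have wS : forall j, j \notin S -> extend w j 0 = 0 by apply: extend_out.
rewrite -{2}(vec_restr_extend w) mul_restr // extend_restr // => i iS.
rewrite mxE big1 // => j _; have [jS|jS] := boolP (j \in S).
  by rewrite XS ?mul0r.
by rewrite wS ?mulr0.
Qed.

End Restriction.

Lemma char_poly_reindex (R : comNzRingType) m n (f : 'I_m -> 'I_n) (X : 'M[R]_n) :
  bijective f -> char_poly (mxsub f f X) = char_poly X.
Proof.
move=> f_bij; have mn : m = n by have := bij_eq_card f_bij; rewrite !card_ord.
subst m; have f_inj := bij_inj f_bij.
have char_sub : char_poly_mx (mxsub f f X) = mxsub f f (char_poly_mx X).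
  by apply/matrixP => i j; rewrite !mxE (inj_eq f_inj).
rewrite /char_poly char_sub; set Q := char_poly_mx X.
have -> : mxsub f f Q = row_perm (perm f_inj) (col_perm (perm f_inj) Q).
  by apply/matrixP => i j; rewrite !mxE !permE.
rewrite row_permE col_permE !det_mulmx !det_perm odd_permV mulrCA -signr_addb.
by rewrite addbb mulr1.
Qed.

Lemma mup_char_polyM (F : fieldType) m n (X : 'M[F]_m) (Y : 'M[F]_n) a :
  mup a (char_poly X * char_poly Y) = (mup a (char_poly X) + mup a (char_poly Y))%N.
Proof. by apply: mupM; apply/monic_neq0/char_poly_monic. Qed.

Lemma mup_char_poly_gt0 (F : fieldType) n (X : 'M[F]_n) a :
  root (char_poly X) a -> (0 < mup a (char_poly X))%N.
Proof.
by move=> Xa; rewrite -XsubC_dvd ?dvdp_XsubCl //; apply/monic_neq0/char_poly_monic.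
Qed.

Section Inaccessible.
Variables (R : realType) (n : nat).
Implicit Types (S T : {set 'I_n}) (X Y : 'M[R]_n) (v : 'cV[R]_n).

Lemma char_poly_inaccessible S X : inaccessible S X ->
  char_poly X = char_poly (mx_restr S X) * char_poly (mx_restr (~: S) X).
Proof.
move=> XS; pose f (k : 'I_(#|S| + #|~: S|)) : 'I_n :=
  match split k with inl i => enum_val i | inr j => enum_val j end.
have f_inj : injective f.
  move=> k l; rewrite /f -[k in _ -> k = _]splitK -[l in _ -> _ = l]splitK.
  case: (split k) => i; case: (split l) => j.
  - by move/enum_val_inj ->.
  - by move=> E; have := enum_valP i; have := enum_valP j; rewrite -E in_setC => /negP.
  - by move=> E; have := enum_valP i; have := enum_valP j; rewrite -E in_setC => + /negP.
  - by move/enum_val_inj ->.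
have f_bij : bijective f.
  by apply: inj_card_bij => //; rewrite !card_ord cardsC card_ord.
have fl k : f (lshift _ k) = enum_val k by rewrite /f (unsplitK (inl k)).
have fr k : f (rshift _ k) = enum_val k by rewrite /f (unsplitK (inr k)).
rewrite -(char_poly_reindex X f_bij).
rewrite -(char_poly_ublock _ (ursubmx (mxsub f f X))); congr char_poly.
rewrite -[LHS]submxK; congr block_mx; apply/matrixP => k l.
- by rewrite mx_restrE 3!mxE !fl.
- rewrite 4!mxE fl fr XS ?enum_valP //.
  by have := enum_valP k; rewrite in_setC.
- by rewrite mx_restrE 3!mxE !fr.
Qed.

Lemma leading_inaccessible X v : nneg_mx X -> leading_eigenvector X v ->
  inaccessible (supp v) X.
Proof.
move=> X0 [_ v0 Xv] i j; rewrite !inE negbK => /eqP vi vj.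
have /matrixP/(_ i 0) := Xv; rewrite entryE vi mulr0 mxE => /eqP.
rewrite psumr_eq0 => [|k _]; last by rewrite mulr_ge0.
move/allP/(_ j (mem_index_enum j)); rewrite mulf_eq0 (negPf vj) orbF.
by move/eqP.
Qed.

Lemma positive_eigen_radius X v c : v != 0 -> nneg_mx X ->
  (forall i, 0 < v i 0) -> X *m v = c *: v -> spectral_radius X = c.
Proof.
move=> v_neq0 X0 v_gt0 Xv; have [i _] := cV_neq0 v_neq0.
have n_gt0 : (0 < n)%N by apply: leq_trans (ltn_ord i).
apply/le_anti/andP; split.
  by apply: (superinvariant_ge n_gt0 X0 v_gt0) => k; rewrite Xv entryE.
apply: (subinvariant_le X0 _ v_neq0) => [k l|k]; first by rewrite ord1 ltW.
by rewrite Xv entryE.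
Qed.

End Inaccessible.

Section Minimal.
Variables (R : realType) (n : nat).
Implicit Types (S T : {set 'I_n}) (X Y : 'M[R]_n) (v w : 'cV[R]_n).

Lemma restr_supp_gt0 v : (forall i, 0 <= v i 0) ->
  forall k, 0 < vec_restr (supp v) v k 0.
Proof.
move=> v0 k; rewrite vec_restrE lt_neqAle v0 eq_sym andbT.
by have := enum_valP k; rewrite inE.
Qed.

Lemma supp_out v j : j \notin supp v -> v j 0 = 0.
Proof. by rewrite inE negbK => /eqP. Qed.

Lemma restr_neq0 S v : (forall j, j \notin S -> v j 0 = 0) -> v != 0 ->
  vec_restr S v != 0.
Proof. by move=> vS; apply: contraNneq => /(restr_eq0 vS) ->. Qed.

Lemma leading_restr_radius X v : nneg_mx X -> leading_eigenvector X v ->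
  spectral_radius (mx_restr (supp v) X) = spectral_radius X.
Proof.
move=> X0 [v_neq0 v0 Xv]; have vS := @supp_out v.
apply: (positive_eigen_radius (restr_neq0 vS v_neq0) (nneg_mx_restr X0)).
  exact: restr_supp_gt0.
by rewrite mul_restr // Xv vec_restrZ.
Qed.

Lemma minimal_leading_restr X v : nneg_mx X -> minimal_leading X v ->
  minimal_leading (mx_restr (supp v) X) (vec_restr (supp v) v).
Proof.
move=> X0 [v_lead v_min]; have [v_neq0 v0 Xv] := v_lead.
have vS := @supp_out v; have rhoE := leading_restr_radius X0 v_lead.
split; first split.
- exact: restr_neq0.
- by move=> k; rewrite vec_restrE.
- by rewrite mul_restr // Xv vec_restrZ rhoE.
move=> w [w_neq0 w0 Xw]; apply/negP => w_prop.
have w_lead : leading_eigenvector X (extend w).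
  split; first by apply: contraNneq w_neq0 => /extend_eq0 ->.
    by move=> i; apply: nneg_extend => k l; rewrite ord1.
  by rewrite mul_extend ?Xw ?rhoE ?extendZ //; apply: leading_inaccessible.
case/negP: (v_min _ w_lead); rewrite supp_extend.
move: w_prop; rewrite !properE => /andP[_ /subsetPn[k kv kw]]; apply/andP; split.
  by apply/fintype.subsetP => _ /imsetP[l _ ->]; apply: enum_valP.
apply/subsetPn; exists (enum_val k); first exact: enum_valP.
by apply: contra kw => /imsetP[l lw /enum_val_inj ->].
Qed.

Lemma minimal_leading_extend S Y w : nneg_mx Y -> inaccessible S Y ->
    spectral_radius (mx_restr S Y) = spectral_radius Y ->
    (forall j, j \notin S -> w j 0 = 0) ->
    minimal_leading (mx_restr S Y) (vec_restr S w) ->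
  minimal_leading Y w.
Proof.
move=> Y0 YS rhoE wS [[w_neq0 w0 Yw] w_min]; rewrite rhoE in Yw.
have w_lead : leading_eigenvector Y w.
  rewrite -(extend_restr wS); split.
  - by apply: contraNneq w_neq0 => /extend_eq0 ->.
  - by move=> i; apply: nneg_extend => k l; rewrite ord1.
  by rewrite mul_extend // Yw extendZ.
split=> // u [u_neq0 u0 Yu]; apply/negP => u_prop.
have uw := proper_sub u_prop.
have uS j : j \notin S -> u j 0 = 0.
  move=> /wS wj; apply: supp_out; apply/negP => /(fintype.subsetP uw).
  by rewrite inE wj eqxx.
have u_lead : leading_eigenvector (mx_restr S Y) (vec_restr S u).
  split; first exact: restr_neq0.
    by move=> k; rewrite vec_restrE.
  by rewrite mul_restr // Yu vec_restrZ rhoE.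
case/negP: (w_min _ u_lead); move: u_prop.
rewrite !properE => /andP[_ /subsetPn[j jw ju]]; apply/andP; split.
  apply/fintype.subsetP => k; rewrite !inE !vec_restrE => ku.
  by have := fintype.subsetP uw (enum_val k); rewrite !inE; apply.
have [/enum_val_onto[k jk]|/wS wj] := boolP (j \in S); last first.
  by move: jw; rewrite inE wj eqxx.
by apply/subsetPn; exists k; [move: jw | move: ju]; rewrite !inE !vec_restrE jk.
Qed.

Lemma minimal_leading_exists X : (0 < n)%N -> nneg_mx X ->
  exists v, minimal_leading X v.
Proof.
move=> n_gt0 X0; have [v v_lead] := leading_exists n_gt0 X0.
have [m] := ubnP #|supp v|; elim: m v v_lead => // m IHm v v_lead /ltnSE vm.
have [[w w_lead wv]|no_w] := pselect (exists2 w, leading_eigenvector X w &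
    supp w \proper supp v).
  by apply: (IHm w w_lead); apply: leq_trans vm; apply: proper_card.
exists v; split=> // w w_lead; apply/negP => wv; apply: no_w.
by exists w.
Qed.

End Minimal.

(** * One pass of the main loop *)

Section Algorithm.
Variables (R : realType) (n : nat) (A : 'M[R]_n) (r : nat).
Hypothesis A_bool : boolean_mx A.
Local Notation rho := (@spectral_radius R _).
Implicit Types (X Y : 'M[R]_n) (v w : 'cV[R]_n) (S T H : {set 'I_n}).

Definition feasible X :=
  [/\ boolean_mx X, mx_ball A r X & forall i j, A i j = 0 -> X i j = 0].

Lemma feasible_init : feasible A.
Proof.
split=> // i; split=> [j|]; first by rewrite mxE; case: (A_bool i j) => ->.
by rewrite big1 // => j _; rewrite subrr normr0.
Qed.

Lemma boolean_nneg m p (X : 'M[R]_(m, p)) : boolean_mx X -> nneg_mx X.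
Proof. by move=> X_bool i j; case: (X_bool i j) => ->. Qed.

Lemma mx_ball_nneg X : mx_ball A r X -> nneg_mx X.
Proof. by move=> XB i j; have [/(_ j)] := XB i; rewrite mxE. Qed.

Lemma row_ball_restr S (a x : 'rV[R]_n) :
  row_ball a r x -> row_ball (row_restr S a) r (row_restr S x).
Proof.
move=> [x0 ax]; split=> [j|]; first by rewrite mxE.
apply: le_trans ax; under eq_bigr do rewrite 2!mxE.
rewrite -(big_enum_val (fun j => `|a 0 j - x 0 j|)) big_mkcond /=.
by apply: ler_sum => j _; case: ifP => // _; apply: normr_ge0.
Qed.

Lemma boolean_restr S X k : boolean_mx X -> boolean_mx (row k (mx_restr S X)).
Proof. by move=> X_bool i j; rewrite !mxE. Qed.

Lemma restr_off_supp S X k : (forall i j, A i j = 0 -> X i j = 0) ->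
  forall l, l \notin supp (row k (mx_restr S A))^T -> row k (mx_restr S X) 0 l = 0.
Proof. by move=> XA l; rewrite inE !mxE negbK => /eqP/XA. Qed.

Lemma mem_minimal_rows X v S k : (enum_val k \in minimal_rows A r X v S) <->
  minimal_row (row k (mx_restr S A)) r (vec_restr S v) (row k (mx_restr S X)).
Proof.
by rewrite /minimal_rows in_set enum_valP /= !row_restrE asboolE.
Qed.

Lemma restr_cost S X v k :
  (mx_restr S X *m vec_restr S v) k 0 =
  \sum_l row k (mx_restr S X) 0 l * vec_restr S v l 0.
Proof. by rewrite mxE; apply: eq_bigr => l _; rewrite [in RHS]mxE. Qed.

Definition loop_inv X v S :=
  [/\ feasible X, minimal_leading X v, S = supp v & 1 <= rho X].

Section LoopState.
Variables (X : 'M[R]_n) (v : 'cV[R]_n) (S : {set 'I_n}).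
Hypothesis inv : loop_inv X v S.
Local Notation X' := (mx_restr S X).
Local Notation v' := (vec_restr S v).

Lemma loop_nneg : nneg_mx X.
Proof. by have [[? _ _] _ _ _] := inv; apply: boolean_nneg. Qed.

Lemma loop_restr_nneg : nneg_mx X'.
Proof. exact/nneg_mx_restr/loop_nneg. Qed.

Lemma loop_lead : leading_eigenvector X v.
Proof. by have [_ [v_lead _] _ _] := inv. Qed.

Lemma loop_out j : j \notin S -> v j 0 = 0.
Proof. by have [_ _ -> _] := inv; apply: supp_out. Qed.

Lemma loop_gt0 k : 0 < v' k 0.
Proof.
have [_ [[_ v0 _] _] SE _] := inv; move: k; rewrite SE.
exact: restr_supp_gt0.
Qed.

Lemma loop_minimal : minimal_leading X' v'.
Proof.
have [_ v_min -> _] := inv; apply: minimal_leading_restr => //.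
exact: loop_nneg.
Qed.

Lemma loop_radius : rho X' = rho X.
Proof.
have [_ _ -> _] := inv.
exact: leading_restr_radius loop_nneg loop_lead.
Qed.

Lemma loop_inaccessible : inaccessible S X.
Proof.
by have [_ _ -> _] := inv; apply: leading_inaccessible loop_lead; apply: loop_nneg.
Qed.

Lemma loop_card : (0 < #|S|)%N.
Proof.
have [[/cV_neq0[k _] _ _] _] := loop_minimal.
exact: leq_trans (ltn_ord k).
Qed.

Lemma basic_setP H : basic_set S X H <->
  exists u : 'cV[R]_#|S|, [/\ u != 0, nneg_mx u, X'^T *m u = rho X' *: u &
    H = supp (extend u)].
Proof.
split=> [[u /(left_leading u loop_restr_nneg)[? ? ?] ->]|[u [? ? ? ->]]].
  by exists u; rewrite supp_extend.
by exists u; [apply/(left_leading u loop_restr_nneg) | rewrite supp_extend].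
Qed.

Lemma basic_set_unique H H1 : basic_set S X H -> basic_set S X H1 -> H = H1.
Proof.
move=> /basic_setP[u [u_neq0 _ uX ->]] /basic_setP[u1 [u1_neq0 _ u1X ->]].
have [c cE] := left_unique loop_minimal loop_gt0 u_neq0 uX u1X.
have c_neq0 : c != 0 by apply: contraNneq u1_neq0 => c0; rewrite cE c0 scale0r.
by apply/setP => j; rewrite !inE cE extendZ mx_scaleE mulf_eq0 (negPf c_neq0).
Qed.

Lemma basic_set_exists : exists H, basic_set S X H.
Proof.
have [u u_lead] := leading_exists loop_card (nneg_tr loop_restr_nneg).
by exists [set enum_val k | k in supp u], u.
Qed.

Lemma update_exists : exists Y, update A r X v S Y.
Proof.
have row_exists i : exists y : 'rV[R]_n,
    if i \in S :\: minimal_rows A r X v S then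
      minimal_row (row_restr S (row i A)) r v' (row_restr S y) /\
      forall j, j \notin S -> y 0 j = A i j
    else y = row i X.
  case: (i \in S :\: _); last by exists (row i X).
  have a_bool : boolean_mx (row_restr S (row i A)) by move=> k j; rewrite !mxE.
  have [x x_min] := minimal_row_exists r v' a_bool.
  exists (\row_j if j \in S then extend x^T j 0 else A i j).
  split=> [|j /negPf jS]; last by rewrite mxE jS.
  rewrite (_ : row_restr _ (\row_j _) = x) //; apply/rowP => k.
  by rewrite mxE [LHS]mxE enum_valP extend_val mxE.
have [y yP] := fin_all_exists row_exists.
exists (\matrix_i y i) => i; have := yP i.
rewrite rowK; case: ifP => // _ [? yA]; split=> // j jS.
by rewrite mxE yA.
Qed.

Section Update.
Variable Y : 'M[R]_n.
Hypothesis upY : update A r X v S Y.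
Local Notation I := (minimal_rows A r X v S).
Local Notation Y' := (mx_restr S Y).

Lemma update_kept i : i \notin S :\: I -> row i Y = row i X.
Proof. by move/negPf => iI; have := upY i; rewrite iI. Qed.

Lemma update_out i : i \notin S -> row i Y = row i X.
Proof. by move=> iS; apply: update_kept; rewrite in_setD (negPf iS) andbF. Qed.

Lemma update_minimal k : enum_val k \notin I ->
  minimal_row (row k (mx_restr S A)) r v' (row k Y').
Proof.
move=> kI; have := upY (enum_val k).
by rewrite in_setD kI enum_valP /= !row_restrE => -[].
Qed.

Lemma update_feasible : feasible Y.
Proof.
have [[X_bool X_ball XA] _ _ _] := inv.
have rowP i : [/\ boolean_mx (row i Y), row_ball (row i A) r (row i Y) &
    forall j, A i j = 0 -> Y i j = 0].
  have [iI|/update_kept YX] := boolP (i \in S :\: I); last first.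
    rewrite YX; split=> // [k j|j Aij]; first by rewrite mxE.
    by have /rowP/(_ j) := YX; rewrite !mxE => ->; apply: XA.
  have := upY i; rewrite iI => -[[x_bool [x_ge0 x_ball] xA _ _] YA].
  have y_in k : Y i (enum_val k) = row_restr S (row i Y) 0 k by rewrite !mxE.
  have Y_bool j : Y i j = 0 \/ Y i j = 1.
    have [/enum_val_onto[k ->]|/YA ->] := boolP (j \in S); last exact: A_bool.
    by rewrite y_in.
  split=> [k j|| j Aij]; first by rewrite mxE.
    split=> [j|]; first by rewrite mxE; case: (Y_bool j) => ->.
    apply: le_trans x_ball; rewrite (sum_supported (S := S)).
      by apply: ler_sum => k _; rewrite !mxE.
    by move=> j /YA; rewrite !mxE => ->; rewrite subrr normr0.
  have [/enum_val_onto[k jk]|/YA ->//] := boolP (j \in S).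
  by rewrite jk y_in xA // inE !mxE -jk Aij eqxx.
split=> [i j|i|i j]; last by have [_ _] := rowP i; apply.
  by have [/(_ 0 j)] := rowP i; rewrite mxE.
by have [] := rowP i.
Qed.

Lemma update_nneg : nneg_mx Y.
Proof. by have [Y_bool _ _] := update_feasible; apply: boolean_nneg. Qed.

Lemma update_inaccessible : inaccessible S Y.
Proof.
move=> i j iS jS; have /rowP/(_ j) := update_out iS; rewrite !mxE => ->.
exact: loop_inaccessible.
Qed.

Lemma update_restr_compl : mx_restr (~: S) Y = mx_restr (~: S) X.
Proof.
apply/matrixP => k l; rewrite !mx_restrE.
have /rowP/(_ (enum_val l)) : row (enum_val k) Y = row (enum_val k) X.
  by apply: update_out; have := enum_valP k; rewrite in_setC.
by rewrite !mxE.
Qed.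

Lemma update_row_kept k : enum_val k \in I -> row k Y' = row k X'.
Proof. by move=> kI; rewrite -!row_restrE update_kept // in_setD kI. Qed.

Lemma restr_Xv : X' *m v' = rho X' *: v'.
Proof. by have [[]] := loop_minimal. Qed.

Lemma update_cost_le k : (Y' *m v') k 0 <= rho X' * v' k 0.
Proof.
rewrite -mx_scaleE -restr_Xv !restr_cost.
have [/update_row_kept ->//|kI] := boolP (enum_val k \in I).
have [[_ X_ball _] _ _ _] := inv.
apply: minimal_row_le (update_minimal kI) _ => [i j||l].
- by rewrite !mxE.
- by rewrite -!row_restrE; apply: row_ball_restr.
- exact/ltW/loop_gt0.
Qed.

Lemma update_cost_eq k : (Y' *m v') k 0 = rho X' * v' k 0 <-> enum_val k \in I.
Proof.
rewrite -mx_scaleE -restr_Xv !restr_cost; split=> [YX|/update_row_kept ->//].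
apply: contraT => kI; have [[X_bool X_ball XA] _ _ _] := inv.
case/negP: (kI); apply/mem_minimal_rows.
apply: minimal_row_eq (update_minimal kI) loop_gt0 _ => //.
- by move=> i j; rewrite !mxE.
- exact: boolean_restr.
- by rewrite -!row_restrE; apply: row_ball_restr.
- exact: restr_off_supp.
Qed.

Lemma update_eq_row k : (Y' *m v') k 0 = rho X' * v' k 0 -> row k Y' = row k X'.
Proof. by move/update_cost_eq/update_row_kept. Qed.

Lemma sub_minimal_rows (u : 'cV[R]_#|S|) : supp (extend u) \subset I <->
  forall k, u k 0 != 0 -> (Y' *m v') k 0 = rho X' * v' k 0.
Proof.
split=> [/fintype.subsetP HI k uk|uI].
  by apply/update_cost_eq/HI; rewrite inE extend_val.
apply/fintype.subsetP => j; rewrite supp_extend => /imsetP[k ku ->].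
by apply/update_cost_eq/uI; move: ku; rewrite inE.
Qed.

Lemma update_stall : I <> S ->
  ~ (forall k, (Y' *m v') k 0 = rho X' * v' k 0).
Proof.
move=> IS Yv; apply: IS; apply/setP => j; apply/idP/idP.
  by rewrite /minimal_rows in_set => /andP[].
by move=> /enum_val_onto[k ->]; apply/update_cost_eq.
Qed.

Let Y'0 : nneg_mx Y'. Proof. exact/nneg_mx_restr/update_nneg. Qed.

Let n_gt0 : (0 < n)%N.
Proof. by have [/cV_neq0[i _] _ _] := loop_lead; apply: leq_trans (ltn_ord i). Qed.

Lemma update_keep H : basic_set S X H -> H \subset I ->
  rho Y' = rho X' /\ leading_simple Y'.
Proof.
move=> /basic_setP[u [u_neq0 u0 uX ->]] /sub_minimal_rows u_eq.
split.
  exact: (lowered_radius_eq Y'0 loop_gt0 update_cost_le update_eq_row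
    u_neq0 u0 uX u_eq).
exact: (lowered_simple loop_restr_nneg Y'0 loop_minimal loop_gt0
    update_cost_le update_eq_row u_neq0 u0 uX u_eq).
Qed.

Lemma update_descend H : basic_set S X H -> ~~ (H \subset I) -> rho Y' < rho X'.
Proof.
move=> /basic_setP[u [u_neq0 u0 uX ->]] HI.
apply: (lowered_radius_lt loop_restr_nneg Y'0 loop_minimal loop_gt0
    update_cost_le update_eq_row u_neq0 uX).
by move/sub_minimal_rows; apply/negP.
Qed.

Lemma char_poly_update :
  char_poly X = char_poly X' * char_poly (mx_restr (~: S) X) /\
  char_poly Y = char_poly Y' * char_poly (mx_restr (~: S) X).
Proof.
split; first exact/char_poly_inaccessible/loop_inaccessible.
rewrite -update_restr_compl; exact/char_poly_inaccessible/update_inaccessible.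
Qed.

Let rootX : root (char_poly X') (rho X).
Proof. by rewrite -loop_radius; have [] := spectral_radiusP loop_card loop_restr_nneg. Qed.

Let rootY : root (char_poly Y) (rho Y).
Proof. by have [] := spectral_radiusP n_gt0 update_nneg. Qed.

Lemma update_radius_le : rho Y' <= rho X' -> rho Y <= rho X.
Proof.
move=> le_Y; have [pX pY] := char_poly_update.
have := rootY; rewrite pY rootM => /orP[|rootC].
  by move/(root_le_spectral_radius Y'0)/le_trans; apply; rewrite -loop_radius.
by apply: (root_le_spectral_radius loop_nneg); rewrite pX rootM rootC orbT.
Qed.

Lemma update_keep_radius H : basic_set S X H -> H \subset I ->
  rho Y = rho X /\
  (mup (rho Y) (char_poly Y) <= mup (rho X) (char_poly X))%N.
Proof.
move=> HS HI; have [rhoY simpleY] := update_keep HS HI.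
have [pX pY] := char_poly_update.
have rhoE : rho Y = rho X.
  apply/le_anti/andP; split; first by apply: update_radius_le; rewrite rhoY.
  have [_ rootY' _] := spectral_radiusP loop_card Y'0.
  apply: (root_le_spectral_radius update_nneg).
  by rewrite pY rootM -loop_radius -rhoY rootY'.
split; first exact: rhoE.
rewrite rhoE pX pY !mup_char_polyM leq_add2r -{1}loop_radius -rhoY simpleY.
exact: mup_char_poly_gt0 rootX.
Qed.

(** If the spectral radius does not drop, it is attained on the complement of
    [S], where the two matrices agree, while the block [S] no longer
    contributes to the multiplicity. *)
Lemma update_descend_radius H : basic_set S X H -> ~~ (H \subset I) ->
  rho Y < rho X \/ rho Y = rho X /\
  (mup (rho Y) (char_poly Y) < mup (rho X) (char_poly X))%N.
Proof.
move=> HS HI; have lt_Y := update_descend HS HI.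
have [pX pY] := char_poly_update.
have := update_radius_le (ltW lt_Y); rewrite le_eqVlt => /orP[/eqP rhoE|]; last by left.
right; split; first exact: rhoE.
rewrite rhoE pX pY !mup_char_polyM ltn_add2r mupNroot.
  exact: mup_char_poly_gt0 rootX.
apply/negP => /(root_le_spectral_radius Y'0).
by rewrite leNgt -loop_radius lt_Y.
Qed.

Lemma update_descend_simple H : basic_set S X H -> ~~ (H \subset I) ->
  leading_simple X -> rho Y < rho X.
Proof.
move=> HS HI; case: (update_descend_radius HS HI) => [lt_Y _|[_ lt_mup]].
  exact: lt_Y.
rewrite /leading_simple => simpleX.
have := leq_ltn_trans (mup_char_poly_gt0 rootY) lt_mup.
by rewrite simpleX ltnn.
Qed.

Lemma update_loop_inv H w : basic_set S X H -> H \subset I ->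
    minimal_leading Y' (vec_restr S w) -> (forall j, j \notin S -> w j 0 = 0) ->
  loop_inv Y w (supp w).
Proof.
move=> HS HI w_min wS; have [rhoY' _] := update_keep HS HI.
have [rhoY _] := update_keep_radius HS HI.
have [_ _ _ rhoX] := inv.
split; [exact: update_feasible | | by [] | by rewrite rhoY].
apply: (minimal_leading_extend update_nneg update_inaccessible _ wS w_min).
exact: etrans rhoY' (etrans loop_radius (esym rhoY)).
Qed.

End Update.
End LoopState.

(** The order along which a run of the main loop descends: with the basic set
    [H] fixed and [v] normalised on [H], the eigenvector decreases. *)
Definition progress X v S Y w T : Prop :=
  exists H c, [/\ basic_set S X H, basic_set T Y H, 0 < c,
    (forall i, w i 0 <= c * v i 0) &
    (forall i, i \in H -> w i 0 = c * v i 0) /\ w <> c *: v].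

Lemma update_progress X v S Y w H : loop_inv X v S -> update A r X v S Y ->
    minimal_rows A r X v S <> S -> basic_set S X H ->
    H \subset minimal_rows A r X v S ->
    minimal_leading (mx_restr S Y) (vec_restr S w) ->
    (forall j, j \notin S -> w j 0 = 0) ->
  progress X v S Y w (supp w).
Proof.
move=> inv upY IS HS HI w_min wS.
have invY := update_loop_inv inv upY HS HI w_min wS.
have [rhoY' _] := update_keep inv upY HS HI.
have [rhoY _] := update_keep_radius inv upY HS HI.
have [u [u_neq0 u0 uX HE]] := (basic_setP inv H).1 HS.
have u_eq : forall k, u k 0 != 0 -> (mx_restr S Y *m vec_restr S v) k 0 =
    spectral_radius (mx_restr S X) * vec_restr S v k 0.
  by apply/(sub_minimal_rows inv upY); rewrite -HE.
have X'0 := loop_restr_nneg inv; have v_min := loop_minimal inv.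
have Y'0 : nneg_mx (mx_restr S Y) by apply/nneg_mx_restr/(update_nneg inv upY).
have rho_gt0 : 0 < rho (mx_restr S X).
  by rewrite (loop_radius inv); have [_ _ _] := inv; apply: lt_le_trans.
have [c [c_gt0 le_w eq_w neq_w]] := lowered_progress X'0 Y'0 v_min (loop_gt0 inv)
  (update_cost_le inv upY) (update_eq_row inv upY) u_neq0 u0 uX u_eq rho_gt0
  w_min.1 (update_stall inv upY IS).
have vS := loop_out inv; have v0 := leading_nneg (loop_lead inv).
have eq_wH i : i \in H -> w i 0 = c * v i 0.
  rewrite HE supp_extend => /imsetP[k ku ->].
  by have := eq_w k; rewrite !vec_restrE; apply; move: ku; rewrite inE.
exists H, c; split; [exact: HS | | exact: c_gt0 | | ].
- have uY : (mx_restr S Y)^T *m u = rho (mx_restr S Y) *: u.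
    rewrite rhoY' -uX; apply/esym.
    by apply: left_agree => k /u_eq/(update_eq_row inv upY).
  have uT j : j \notin supp w -> extend u j 0 = 0.
    move=> jw; apply/eqP/negPn/negP => ju; case/negP: jw.
    have jH : j \in H by rewrite HE inE.
    rewrite inE (eq_wH j jH).
    apply: mulf_neq0; apply: lt0r_neq0; first exact: c_gt0.
    move: jH; rewrite HE supp_extend => /imsetP[k _ ->].
    by rewrite -vec_restrE; apply: (loop_gt0 inv).
  apply/(basic_setP invY); exists (vec_restr (supp w) (extend u)); split.
  - apply: restr_neq0 uT _; apply: contraNneq u_neq0 => /extend_eq0 ->.
    exact: eqxx.
  - exact/nneg_vec_restr/nneg_extend.
  - have rhoT : rho (mx_restr (supp w) Y) = rho (mx_restr S Y).
      exact: etrans (loop_radius invY) (etrans rhoY (etrans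
        (esym (loop_radius inv)) (esym rhoY'))).
    rewrite rhoT mx_restr_tr mul_restr; last exact: uT.
    apply/matrixP => k l; rewrite ord1 mx_scaleE !vec_restrE.
    have [kS|] := boolP (enum_val k \in S); last first.
      by move/wS => wk; have := enum_valP k; rewrite inE wk eqxx.
    have [i ->] := enum_val_onto kS; rewrite extend_val -mx_scaleE -uY mx_restr_tr.
    rewrite -{2}(vec_restr_extend u) mul_restr ?vec_restrE; first by [].
    exact: extend_out.
  by rewrite extend_restr; [exact: HE | exact: uT].
- move=> i; have [/enum_val_onto[k ->]|iS] := boolP (i \in S).
    by have := le_w k; rewrite !vec_restrE.
  by rewrite (wS i iS) (vS i iS) mulr0 lexx.
by split; [exact: eq_wH | move=> wE; apply: neq_w; rewrite wE vec_restrZ].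
Qed.

Lemma progress_trans X v S Y w T Z x U : loop_inv Y w T ->
  progress X v S Y w T -> progress Y w T Z x U -> progress X v S Z x U.
Proof.
move=> invY [H [c [HX HY c0 le_w [eq_w _]]]] [H1 [d [HY1 HZ d0 le_x [eq_x neq_x]]]].
have HE := basic_set_unique invY HY HY1; subst H1.
have le_dw i : d * w i 0 <= d * c * v i 0 by rewrite -mulrA ler_pM2l.
exists H, (d * c); split=> //; first exact: mulr_gt0.
  by move=> i; apply: le_trans (le_x i) (le_dw i).
split=> [i iH|xE]; first by rewrite eq_x // eq_w // mulrA.
apply: neq_x; apply/matrixP => i j; rewrite ord1; apply/le_anti/andP; split.
  by rewrite mx_scaleE.
by rewrite xE !mx_scaleE.
Qed.

Lemma progress_neq X v S w T : loop_inv X v S -> loop_inv X w T ->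
  ~ progress X v S X w T.
Proof.
move=> inv invw [H [c [HS HT c_gt0 le_w [eq_w neq_w]]]]; apply: neq_w.
have wS j : j \notin S -> w j 0 = 0.
  move=> jS; apply/le_anti/andP; split.
    by apply: le_trans (le_w j) _; rewrite (loop_out inv jS) mulr0.
  exact: (leading_nneg (loop_lead invw)).
have w_lead := loop_lead invw.
have w_lead' : leading_eigenvector (mx_restr S X) (vec_restr S w).
  have [w_neq0 w0 Xw] := w_lead; split; first exact: restr_neq0.
    by move=> k; rewrite vec_restrE.
  by rewrite mul_restr // Xw vec_restrZ (loop_radius inv).
have [d _ wE] := leading_unique (loop_minimal inv) (loop_gt0 inv) w_lead'.
have [u [/cV_neq0[k uk] _ _ HE]] := (basic_setP inv H).1 HS.
have kH : enum_val k \in H by rewrite HE inE extend_val.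
have /matrixP/(_ k 0) := wE; rewrite mx_scaleE !vec_restrE (eq_w _ kH) => cd.
have v_neq0 : v (enum_val k) 0 != 0.
  by rewrite -vec_restrE gt_eqF // (loop_gt0 inv).
have -> : c = d by apply: (mulIf v_neq0).
rewrite -(extend_restr wS) wE extendZ extend_restr //.
exact: (loop_out inv).
Qed.

End Algorithm.

(** * Runs of the algorithm *)

Section Runs.
Variables (R : realType) (n : nat) (A : 'M[R]_n) (r : nat).
Hypothesis A_bool : boolean_mx A.
Local Notation rho := (@spectral_radius R _).
Implicit Types (X Y Z : 'M[R]_n) (v w : 'cV[R]_n) (S T H : {set 'I_n}).

(** At the least positive entry of a Perron vector some edge leads to a positive
    entry, which is at least as large. *)
Lemma boolean_radius_ge1 m (X : 'M[R]_m) : boolean_mx X -> 0 < rho X -> 1 <= rho X.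
Proof.
case: m X => [|m] X X_bool; first by rewrite spectral_radius0 ltxx.
move=> rho_gt0; have X0 := boolean_nneg X_bool.
have [v [v_neq0 v0 Xv]] := leading_exists (ltn0Sn m) X0.
have [i0 vi0] := cV_neq0 v_neq0.
have [i /= vi mini] := exists_max (P := [pred i | v i 0 != 0]) (fun i => - v i 0) vi0.
have vi_gt0 : 0 < v i 0 by rewrite lt_neqAle eq_sym vi v0.
have /matrixP/(_ i 0) := Xv; rewrite mx_scaleE mxE => Xvi.
have [[j Xij]|no_j] := pselect (exists j, X i j * v j 0 != 0).
  have vj : v j 0 != 0 by apply: contraNneq Xij => ->; rewrite mulr0.
  have X1 : X i j = 1.
    by case: (X_bool i j) => // X_0; rewrite X_0 mul0r eqxx in Xij.
  rewrite -(ler_pM2r vi_gt0) mul1r -Xvi (bigD1 j) //= X1 mul1r.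
  have := mini j vj; rewrite lerN2 => /le_trans; apply.
  by rewrite lerDl sumr_ge0 // => k _; rewrite mulr_ge0.
have : 0 < rho X * v i 0 by rewrite mulr_gt0.
rewrite -Xvi big1 ?ltxx // => j _; apply/eqP/negPn/negP => Xij.
by apply: no_j; exists j.
Qed.

Lemma stable_solution X : feasible A r X -> rho X < 1 -> solution A r X.
Proof.
move=> [X_bool X_ball _] lt1; split=> [|Y Y_ball]; first exact: X_ball.
apply: (@le_trans _ _ 0); last exact/spectral_radius_ge0/(mx_ball_nneg Y_ball).
by rewrite leNgt; apply/negP => /(boolean_radius_ge1 X_bool); rewrite leNgt lt1.
Qed.

(** When all rows are minimal, [Y v >= rho v] for every [Y] in the ball, since
    no row has a smaller inner product with [v] than a minimal one. *)
Lemma return_solution X v S : loop_inv A r X v S ->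
  minimal_rows A r X v S = S -> solution A r X.
Proof.
move=> inv IS; have [[_ X_ball _] _ _ _] := inv; split=> [|Y Y_ball]; first exact: X_ball.
have Y0 := mx_ball_nneg Y_ball; have v_lead := loop_lead inv.
have [v_neq0 _ Xv] := v_lead; have v0 := leading_nneg v_lead.
apply: (subinvariant_le Y0 v0 v_neq0) => i.
have vS := loop_out inv.
have [/enum_val_onto[k ->]|iS] := boolP (i \in S); last first.
  by rewrite (vS i iS) mulr0; apply: nneg_mul.
rewrite -mx_scaleE -Xv -!vec_restrE -!mul_restr // !restr_cost.
have aS : boolean_mx (row k (mx_restr S A)) by apply: boolean_restr.
apply: (minimal_row_le aS).
- by rewrite -!row_restrE; apply: row_ball_restr.
- by apply/mem_minimal_rows; rewrite IS enum_valP.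
- by move=> l; apply/ltW/(loop_gt0 inv).
Qed.

Definition state_inv (s : state R n) : Prop :=
  match s with
  | Outer X => feasible A r X
  | Loop X v T => loop_inv A r X v T
  | Returned X => solution A r X
  end.

Lemma supp_full S w : (forall j, j \notin S -> w j 0 = 0) ->
  (forall k, 0 < vec_restr S w k 0) -> supp w = S.
Proof.
move=> wS w_gt0; apply/setP => j; rewrite inE.
have [/enum_val_onto[k ->]|/wS ->] := boolP (j \in S); last by rewrite eqxx.
by rewrite -vec_restrE gt_eqF.
Qed.

Lemma good_step s t : state_inv s -> step A r s t -> state_inv t.
Proof.
move=> + st; case: st => /=.
- by move=> X lt1 X_feas; apply: stable_solution.
- by move=> X v ge1 v_min X_feas; apply: And4.
- by move=> X v S IS inv; apply: return_solution IS.
- move=> X v S H Y w IS upY HS HI w_min wS w_gt0 inv.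
  rewrite -[S in loop_inv _ _ _ _ S](supp_full wS w_gt0).
  exact (update_loop_inv A_bool inv upY HS HI w_min wS).
- move=> X v S H Y w IS upY HS HI w_min wS _ inv.
  exact (update_loop_inv A_bool inv upY HS HI w_min wS).
- by move=> X v S H Y IS upY HS HI inv; apply: (update_feasible A_bool inv upY).
Qed.

Lemma reachable_good s : reachable A r s -> state_inv s.
Proof.
move=> run; have := Operators_Properties.clos_rt_rtn1 _ _ _ _ run.
elim=> [|t u tu _ good_t]; first exact: feasible_init.
exact: good_step tu.
Qed.

Local Notation mult X := (mup (rho X) (char_poly X)).

Definition lower Y X := rho Y < rho X \/ rho Y = rho X /\ (mult Y < mult X)%N.
Definition no_higher Y X := rho Y = rho X /\ (mult Y <= mult X)%N.

Lemma lower_trans Z Y X : lower Z Y -> lower Y X -> lower Z X.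
Proof.
move=> [lt_ZY|[eq_ZY mu_ZY]] [lt_YX|[eq_YX mu_YX]]; rewrite /lower.
- by left; apply: lt_trans lt_YX.
- by left; rewrite -eq_YX.
- by left; rewrite eq_ZY.
- by right; split; [rewrite eq_ZY | apply: ltn_trans mu_YX].
Qed.

Lemma lower_no_higher Z Y X : lower Z Y -> no_higher Y X -> lower Z X.
Proof.
move=> [lt_ZY|[eq_ZY mu_ZY]] [eq_YX mu_YX]; rewrite /lower.
- by left; rewrite -eq_YX.
- by right; split; [rewrite eq_ZY | apply: leq_trans mu_YX].
Qed.

Lemma no_higher_lower Z Y X : no_higher Z Y -> lower Y X -> lower Z X.
Proof.
move=> [eq_ZY mu_ZY] [lt_YX|[eq_YX mu_YX]]; rewrite /lower.
- by left; rewrite eq_ZY.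
- by right; split; [rewrite eq_ZY | apply: leq_ltn_trans mu_YX].
Qed.

Lemma no_higher_trans Z Y X : no_higher Z Y -> no_higher Y X -> no_higher Z X.
Proof.
move=> [eq_ZY mu_ZY] [eq_YX mu_YX]; split; first by rewrite eq_ZY.
exact: leq_trans mu_YX.
Qed.

Lemma lower_irr X : ~ lower X X.
Proof. by case=> [|[_]]; rewrite ?ltxx ?ltnn. Qed.

(** The invariant of a run that starts in the main loop.  The outer iterations
    lower the pair of the spectral radius and its multiplicity; within the main
    loop this pair does not rise, and the eigenvector decreases. *)
Definition descends X v S (t : state R n) : Prop :=
  match t with
  | Outer Y => lower Y X
  | Loop Y w T => lower Y X \/ no_higher Y X /\ progress X v S Y w T
  | Returned _ => True
  end.

Lemma descends_step X v S t : loop_inv A r X v S ->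
  step A r (Loop X v S) t -> descends X v S t.
Proof.
move=> inv; move E: (Loop X v S) => s st.
case: st E => //.
- move=> X1 v1 S1 H Y w IS upY HS HI w_min wS w_gt0 [? ? ?]; subst X1 v1 S1.
  right; split; first exact: (update_keep_radius A_bool inv upY HS HI).
  have := update_progress A_bool inv upY IS HS HI w_min wS.
  by rewrite (supp_full wS w_gt0).
- move=> X1 v1 S1 H Y w IS upY HS HI w_min wS _ [? ? ?]; subst X1 v1 S1.
  right; split; first exact: (update_keep_radius A_bool inv upY HS HI).
  exact (update_progress A_bool inv upY IS HS HI w_min wS).
- move=> X1 v1 S1 H Y IS upY HS HI [? ? ?]; subst X1 v1 S1.
  exact (update_descend_radius A_bool inv upY HS HI).
Qed.

Lemma descends_trans X v S t t1 : state_inv t -> descends X v S t ->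
  step A r t t1 -> descends X v S t1.
Proof.
case: t => [Y|Y w T|Y] /=.
- move=> _ lt_YX; move E: (Outer Y) => s st; case: st E => //.
  by move=> Y1 w _ _ [<-]; left.
- move=> inv XY /(descends_step inv); case: t1 => [Z|Z x U|Z] //=.
    by case: XY => [lt_YX|[le_YX _]] lt_ZY;
      [apply: lower_trans lt_YX | apply: lower_no_higher le_YX].
  case: XY => [lt_YX|[le_YX pXY]] [lt_ZY|[le_ZY pYZ]].
  - by left; apply: lower_trans lt_YX.
  - by left; apply: no_higher_lower lt_YX.
  - by left; apply: lower_no_higher le_YX.
  - right; split; first exact: no_higher_trans le_YX.
    exact: progress_trans inv pXY pYZ.
- by move=> _ _; move E: (Returned Y) => s st; case: st E.
Qed.

Lemma good_trans s t : state_inv s -> Relation_Operators.clos_trans _ (step A r) s t -> state_inv t.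
Proof.
move=> good_s run; have := Operators_Properties.clos_trans_tn1 _ _ _ _ run.
elim=> [u|u u1 uu1 _] st.
  exact: good_step st.
exact: good_step st uu1.
Qed.

Lemma run_descends X v S t : loop_inv A r X v S ->
  Relation_Operators.clos_trans _ (step A r) (Loop X v S) t -> descends X v S t.
Proof.
move=> inv run; have := Operators_Properties.clos_trans_tn1 _ _ _ _ run.
elim=> [u|u u1 uu1 st XU]; first exact: descends_step.
apply: descends_trans uu1 => //; apply: (@good_trans (Loop X v S)) => //.
exact: Operators_Properties.clos_tn1_trans.
Qed.

Lemma no_cycle X v S Y w T : loop_inv A r X v S ->
  Relation_Operators.clos_trans _ (step A r) (Loop X v S) (Loop Y w T) -> X <> Y.
Proof.
move=> inv run XY; subst Y; have := good_trans (s := Loop X v S) inv run.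
have := run_descends inv run => /= -[/lower_irr//|[_ XwT]] invw.
exact: progress_neq inv invw XwT.
Qed.

End Runs.

Section Termination.
Variables (R : realType) (n : nat) (A : 'M[R]_n) (r : nat).
Hypothesis A_bool : boolean_mx A.
Local Notation rho := (@spectral_radius R _).
Local Notation clos_trans := (Relation_Operators.clos_trans _ (step A r)).

Lemma outer_minimal X : feasible A r X -> 1 <= rho X ->
  exists v, minimal_leading X v.
Proof.
move=> [X_bool _ _] ge1; apply: minimal_leading_exists (boolean_nneg X_bool).
rewrite lt0n; apply/eqP => n0; move: X {X_bool} ge1.
rewrite n0 => X; rewrite spectral_radius0.
by rewrite leNgt ltr01.
Qed.

Lemma step_exists s : state_inv A r s ->
  (exists X, s = Returned X) \/ exists t, step A r s t.
Proof.
case: s => [X|X v T|X] /= inv; last by left; exists X.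
  right; have [lt1|ge1] := ltP (rho X) 1; first by exists (Returned X); constructor.
  have [v v_min] := outer_minimal inv ge1.
  by exists (Loop X v (supp v)); constructor.
right; have [IS|/eqP IS] := eqVneq (minimal_rows A r X v T) T.
  by exists (Returned X); constructor.
have [Y upY] : exists Y, update A r X v T Y by apply: update_exists.
have [H HS] := basic_set_exists inv.
have [HI|HI] := boolP (H \subset minimal_rows A r X v T); last first.
  by exists (Outer Y); apply: step_descend IS upY HS HI.
have Y0 := nneg_mx_restr (S := T) (update_nneg A_bool inv upY).
have [w w_min] := minimal_leading_exists (loop_card inv) Y0.
have wT := @extend_out _ _ T w.
rewrite -(vec_restr_extend w) in w_min.
have [w_gt0|w_ngt0] := pselect (forall k, 0 < vec_restr T (extend w) k 0).
  exists (Loop Y (extend w) T); exact: (step_keep IS upY HS HI w_min).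
exists (Loop Y (extend w) (supp (extend w))).
exact: (step_shrink IS upY HS HI w_min).
Qed.

Lemma step_returned X t : ~ step A r (Returned X) t.
Proof. by move E: (Returned X) => s st; case: st E. Qed.

Lemma step_outer X t : step A r (Outer X) t ->
  t = Returned X \/ exists v T, t = Loop X v T.
Proof.
move E: (Outer X) => s st; case: st E => // X1.
  by move=> _ [<-]; left.
by move=> v _ _ [<-]; right; exists v, (supp v).
Qed.

(** An infinite run meets infinitely many states of the main loop, whose
    matrices are Boolean and pairwise distinct. *)
Lemma no_infinite_run :
  ~ exists s : nat -> state R n, s 0%N = Outer A /\ forall k, step A r (s k) (s k.+1).
Proof.
case=> s [s0 s_step].
have good_s k : state_inv A r (s k).
  elim: k => [|k IHk]; first by rewrite s0; apply: feasible_init.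
  exact: good_step (s_step k).
have s_run i j : (i < j)%N -> clos_trans (s i) (s j).
  elim: j => // j IHj; rewrite ltnS leq_eqVlt => /orP[/eqP ->|/IHj run].
    exact: Relation_Operators.t_step.
  by apply: Relation_Operators.t_trans run _; apply: Relation_Operators.t_step.
have loop_at k : exists m X, (k.*2 <= m <= k.*2.+1)%N /\
    exists v T, s m = Loop X v T.
  have := s_step k.*2; case E : (s k.*2) => [X|X v T|X].
  - move/step_outer => [E1|[v [T E1]]].
      by have := s_step k.*2.+1; rewrite E1 => /step_returned.
    exists k.*2.+1, X; split; first by rewrite leqnSn leqnn.
    by exists v, T.
  - move=> _; exists k.*2, X; split; first by rewrite leqnn leqnSn.
    by exists v, T.
  - by move/step_returned.
have [m mP] := choice loop_at; have {mP}[X XP] := choice mP.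
have X_neq i j : (i < j)%N -> X i <> X j.
  move=> ij; have [/andP[_ mi] [v [T si]]] := XP i.
  have [/andP[mj _] [w [U sj]]] := XP j.
  apply: (@no_cycle _ _ A r A_bool _ v T _ w U).
    by have := good_s (m i); rewrite si.
  rewrite -si -sj; apply: s_run; apply: leq_ltn_trans mi _.
  by apply: leq_trans mj; rewrite -doubleS leq_double.
have X_bool i : boolean_mx (X i).
  have [_ [v [T si]]] := XP i; have := good_s (m i).
  by rewrite si => -[[]].
pose N := #|{: 'M[bool]_n}|.
pose f (i : 'I_N.+1) : 'M[bool]_n := map_mx (fun a : R => a != 0) (X i).
have f_inj : injective f.
  move=> i j fij; have Xij : X i = X j.
    apply/matrixP => k l; have /matrixP/(_ k l) := fij; rewrite !mxE.
    by case: (X_bool i k l) => ->; case: (X_bool j k l) => ->;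
      rewrite ?eqxx ?oner_eq0.
  apply: val_inj; case: (ltngtP i j) => // lt_ij; first by case: (X_neq _ _ lt_ij).
  by case: (X_neq _ _ lt_ij).
by have := leq_card f f_inj; rewrite card_ord ltnn.
Qed.

End Termination.
Theorem theorem2 (R : realType) (n : nat) (A : 'M[R]_n) (r : nat)
    (A_bool : boolean_mx A) :
  (* every iteration is well-defined *)
  (forall X, reachable A r (Outer X) ->
     boolean_mx X /\
     (1 <= spectral_radius X -> exists v, minimal_leading X v)) /\
  (forall X v S, reachable A r (Loop X v S) ->
     [/\ boolean_mx X, minimal_leading X v & S = supp v] /\
     [/\ minimal_leading (mx_restr S X) (vec_restr S v),
         forall k, 0 < vec_restr S v k 0,
         forall w, leading_eigenvector (mx_restr S X) w ->
           exists2 c, 0 < c & w = c *: vec_restr S v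
       & exists! H, basic_set S X H]) /\
  (forall s, reachable A r s ->
     (exists X, s = Returned X) \/ exists t, step A r s t) /\
  (* the assertions made in the main loop are correct *)
  (forall X v S H Y, reachable A r (Loop X v S) ->
     minimal_rows A r X v S <> S -> update A r X v S Y -> basic_set S X H ->
     (H \subset minimal_rows A r X v S ->
        spectral_radius (mx_restr S Y) = spectral_radius (mx_restr S X) /\
        leading_simple (mx_restr S Y)) /\
     (~~ (H \subset minimal_rows A r X v S) ->
        spectral_radius (mx_restr S Y) < spectral_radius (mx_restr S X) /\
        (leading_simple X -> spectral_radius Y < spectral_radius X))) /\
  (* no cycling: the main loop never meets the same matrix twice *)
  (forall X v S Y w T, reachable A r (Loop X v S) ->
     Relation_Operators.clos_trans _ (step A r) (Loop X v S) (Loop Y w T) ->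
     X <> Y) /\
  (* every run is finite *)
  (~ exists s : nat -> state R n,
       s 0%N = Outer A /\ forall k, step A r (s k) (s k.+1)) /\
  (* the returned matrix is a global minimiser *)
  (forall X, reachable A r (Returned X) -> solution A r X).
Proof.
split.
  move=> X /(reachable_good A_bool) X_feas; split; first by case: X_feas.
  exact: outer_minimal X_feas.
split.
  move=> X v S /(reachable_good A_bool) inv; split.
    by have [[X_bool _ _] v_min SE _] := inv.
  split; first exact: loop_minimal inv.
  - exact: loop_gt0 inv.
  - exact: leading_unique (loop_minimal inv) (loop_gt0 inv).
  have [H HS] := basic_set_exists inv; exists H; split=> // H1 HS1.
  exact (basic_set_unique inv HS HS1).
split.
  by move=> s /(reachable_good A_bool); apply: step_exists.
split.
  move=> X v S H Y /(reachable_good A_bool) inv _ upY HS; split=> HI.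
    exact (update_keep A_bool inv upY HS HI).
  split; first exact (update_descend A_bool inv upY HS HI).
  exact (update_descend_simple A_bool inv upY HS HI).
split.
  by move=> X v S Y w T /(reachable_good A_bool); apply: no_cycle.
split; first exact: no_infinite_run.
by move=> X /(reachable_good A_bool).
Qed.
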